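(* Let $\mathbf{X}$ be a geometric stack. Every Cartesian presheaf $\mathcal{F}\in\mathsf{Crt}(\mathbf{X})$ is a sheaf of $\mathcal{O}_{\mathbf{X}}$-modules on the site $\mathsf{Aff}_{\mathsf{fppf}}/\mathbf{X}$.
   Context: Stacks are stacks in groupoids for the étale topology on affine schemes over a fixed base scheme; algebraic stacks are in the sense of Laumon–Moret-Bailly. A geometric stack is an algebraic stack $\mathbf{X}$ whose diagonal $\mathbf{X}\to\mathbf{X}\times\mathbf{X}$ is representable by affine schemes and which admits a smooth surjective morphism from an affine scheme. The category $\mathsf{Aff}/\mathbf{X}$ has as objects the pairs $(U,u)$ with $U$ an affine scheme and $u\colon U\to\mathbf{X}$ a flat finitely presented 1-morphism; a morphism $(f,\alpha)\colon(U,u)\to(V,v)$ is a morphism of schemes $f\colon U\to V$ with a 2-morphism $\alpha\colon u\Rightarrow vf$; composition is $(g,\beta)\circ(f,\alpha)=(gf,\beta f\circ\alpha)$. The site $\mathsf{Aff}_{\mathsf{fppf}}/\mathbf{X}$ is this category with coverings the finite families $\{(f_i,\alpha_i)\colon(U_i,u_i)\to(V,v)\}$ with every $f_i$ flat and finitely presented and the $f_i$ jointly surjective. The presheaf of rings $\mathcal{O}=\mathcal{O}_{\mathbf{X}}$ is $\mathcal{O}(U,u)=B$ for $U=\operatorname{Spec}(B)$. A presheaf of $\mathcal{O}$-modules $\mathcal{M}$ on $\mathsf{Aff}/\mathbf{X}$ is Cartesian if for every morphism $(f,\alpha)\colon(U,u)\to(V,v)$ the induced $\mathcal{O}(U,u)$-linear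 map $\mathcal{O}(U,u)\otimes_{\mathcal{O}(V,v)}\mathcal{M}(V,v)\to\mathcal{M}(U,u)$ is an isomorphism. $\mathsf{Crt}(\mathbf{X})$ denotes the category of Cartesian presheaves. *)

(* Defs.v *)
From HB Require Import structures.
From mathcomp Require Import all_boot all_algebra.
From mathcomp Require Import generic_quotient boolp.

Set Implicit Arguments.
Unset Strict Implicit.
Unset Printing Implicit Defensive.
Import GRing.Theory.
Local Open Scope ring_scope.
Local Open Scope quotient_scope.

(* Affine schemes are represented by their rings of functions.  Rings are      *)
(* [comPzRingType]s, so that the zero ring (the empty scheme) is allowed, and  *)
(* a morphism Spec B -> Spec A is a ring morphism A -> B.                      *)

Definition generates_unit (A : comPzRingType) (J : A -> Prop) : Prop :=
  exists (n : nat) (c j : 'I_n -> A),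
    (forall i, J (j i)) /\ \sum_i c i * j i = 1.

Definition image_set (A B : comPzRingType) (f : A -> B) (J : A -> Prop) :
    B -> Prop :=
  fun b => exists2 a, J a & b = f a.

Definition field_like (A : comPzRingType) : Prop :=
  (1 : A) <> 0 /\ forall a : A, a <> 0 -> exists b, a * b = 1.

Definition prime_set (A : comPzRingType) (P : A -> Prop) : Prop :=
  [/\ P 0, forall a b, P a -> P b -> P (a + b), forall a b, P b -> P (a * b),
      ~ P 1 & forall a b, P (a * b) -> P a \/ P b].

(* The morphisms Spec (B i) -> Spec A are jointly surjective. *)
Definition jointly_surjective (A : comPzRingType) (I : Type)
    (B : I -> comPzRingType) (f : forall i, {rmorphism A -> B i}) : Prop :=
  forall P : A -> Prop, prime_set P ->
  exists (i : I) (Q : B i -> Prop),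
    prime_set Q /\ forall a, P a <-> Q (f i a).

(* B = A[1/a], by its universal property. *)
Definition is_localization (A B : comPzRingType) (a : A)
    (l : {rmorphism A -> B}) : Prop :=
  (exists b, l a * b = 1) /\
  forall (C : comPzRingType) (g : {rmorphism A -> C}),
    (exists c, g a * c = 1) ->
    exists h : {rmorphism B -> C}, h \o l =1 g /\
      forall h' : {rmorphism B -> C}, h' \o l =1 g -> h' =1 h.

(* A polynomial in n variables, as a list of (coefficient, exponents); the     *)
(* library's polynomials exclude the zero ring of coefficients.                *)
Definition polynomial_expr (A : comPzRingType) (n : nat) : Type :=
  seq (A * ('I_n -> nat)).

Definition eval_expr (A B : comPzRingType) (f : A -> B) (n : nat)
    (b : 'I_n -> B) (P : polynomial_expr A n) : B :=
  \sum_(t <- P) f t.1 * \prod_i b i ^+ t.2 i.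

(* B = A[x_1, ..., x_n] / (P_1, ..., P_m), with x_i mapped to b i. *)
Definition is_presentation (A B : comPzRingType) (f : {rmorphism A -> B})
    (n : nat) (b : 'I_n -> B) (m : nat) (P : 'I_m -> polynomial_expr A n) :
    Prop :=
  (forall k, eval_expr f b (P k) = 0) /\
  forall (C : comPzRingType) (g : {rmorphism A -> C}) (c : 'I_n -> C),
    (forall k, eval_expr g c (P k) = 0) ->
    exists h : {rmorphism B -> C}, (h \o f =1 g /\ h \o b =1 c) /\
      forall h' : {rmorphism B -> C}, h' \o f =1 g -> h' \o b =1 c -> h' =1 h.

Definition finitely_presented (A B : comPzRingType) (f : {rmorphism A -> B}) :
    Prop :=
  exists (n : nat) (b : 'I_n -> B) (m : nat) (P : 'I_m -> polynomial_expr A n),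
    is_presentation f b P.

(* The tensor product B (x)_A M along f : A -> B : formal sums of pure tensors *)
(* (b, m) modulo the congruence generated by the usual relations.              *)
Inductive tensor_eq (A B : comPzRingType) (f : {rmorphism A -> B})
    (M : lmodType A) : seq (B * M) -> seq (B * M) -> Prop :=
| tensor_refl s : tensor_eq f s s
| tensor_sym s t : tensor_eq f s t -> tensor_eq f t s
| tensor_trans s t u : tensor_eq f s t -> tensor_eq f t u -> tensor_eq f s u
| tensor_cat s s' t t' :
    tensor_eq f s s' -> tensor_eq f t t' -> tensor_eq f (s ++ t) (s' ++ t')
| tensor_catC s t : tensor_eq f (s ++ t) (t ++ s)
| tensor_zero (m : M) : tensor_eq f [:: (0, m)] [::]
| tensor_addl b b' (m : M) :
    tensor_eq f [:: (b + b', m)] [:: (b, m); (b', m)]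
| tensor_addr b (m m' : M) :
    tensor_eq f [:: (b, m + m')] [:: (b, m); (b, m')]
| tensor_balanced b a (m : M) :
    tensor_eq f [:: (b * f a, m)] [:: (b, a *: m)].

Definition tensor_eqb (A B : comPzRingType) (f : {rmorphism A -> B})
    (M : lmodType A) : rel (seq (B * M)) :=
  fun s t => `[< tensor_eq f s t >].

Lemma tensor_eqb_equiv (A B : comPzRingType) (f : {rmorphism A -> B})
    (M : lmodType A) : equiv_class_of (tensor_eqb f (M := M)).
Proof.
split.
- by move=> s; apply/asboolP; exact: tensor_refl.
- by move=> s t; apply/asboolP/asboolP; exact: tensor_sym.
- move=> t s u /asboolP st /asboolP tu; apply/asboolP.
  exact: tensor_trans st tu.
Qed.

Canonical tensor_equiv (A B : comPzRingType) (f : {rmorphism A -> B})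
    (M : lmodType A) : equiv_rel (seq (B * M)) :=
  EquivRelPack (tensor_eqb_equiv f M).

Definition tensor (A B : comPzRingType) (f : {rmorphism A -> B})
    (M : lmodType A) : Type := {eq_quot (tensor_equiv f M)}.

Lemma tensor_piE (A B : comPzRingType) (f : {rmorphism A -> B})
    (M : lmodType A) (s t : seq (B * M)) :
  tensor_eq f s t <->
  \pi_({eq_quot (tensor_equiv f M)}) s = \pi_({eq_quot (tensor_equiv f M)}) t.
Proof. by split=> [st|/eqmodP/asboolP //]; apply/eqmodP/asboolP. Qed.

(* id_B (x) phi : B (x)_A M -> B (x)_A N *)
Definition tensor_map (A B : comPzRingType) (f : {rmorphism A -> B})
    (M N : lmodType A) (phi : {linear M -> N}) (x : tensor f M) :
    tensor f N :=
  \pi_({eq_quot (tensor_equiv f N)}) [seq (p.1, phi p.2) | p <- repr x].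

Lemma tensor_map_pi (A B : comPzRingType) (f : {rmorphism A -> B})
    (M N : lmodType A) (phi : {linear M -> N}) (s : seq (B * M)) :
  tensor_map phi (\pi_({eq_quot (tensor_equiv f M)}) s) =
  \pi_({eq_quot (tensor_equiv f N)}) [seq (p.1, phi p.2) | p <- s].
Proof.
apply/tensor_piE.
have : tensor_eq f (repr (\pi_({eq_quot (tensor_equiv f M)}) s)) s.
  by apply/tensor_piE; rewrite reprK.
move: (repr _) => r; elim=> /= {r s}.
- by move=> s; exact: tensor_refl.
- by move=> s t _; exact: tensor_sym.
- by move=> s t u _ st _; exact: tensor_trans.
- by move=> s s' t t' _ h _ h'; rewrite !map_cat; exact: tensor_cat.
- by move=> s t; rewrite !map_cat; exact: tensor_catC.
- by move=> m; exact: tensor_zero.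
- by move=> b b' m; exact: tensor_addl.
- by move=> b m m'; rewrite linearD; exact: tensor_addr.
- by move=> b a m; rewrite linearZ; exact: tensor_balanced.
Qed.

(* B (x)_A M -> N, b (x) m |-> b * phi m, for phi linear along f : A -> B. *)
Definition tensor_ind (A B : comPzRingType) (f : {rmorphism A -> B})
    (M : lmodType A) (N : lmodType B) (phi : {linear M -> N | f \; *:%R})
    (x : tensor f M) : N :=
  \sum_(p <- repr x) p.1 *: phi p.2.

Lemma tensor_ind_pi (A B : comPzRingType) (f : {rmorphism A -> B})
    (M : lmodType A) (N : lmodType B) (phi : {linear M -> N | f \; *:%R})
    (s : seq (B * M)) :
  tensor_ind phi (\pi_({eq_quot (tensor_equiv f M)}) s) =
  \sum_(p <- s) p.1 *: phi p.2.
Proof.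
rewrite /tensor_ind.
have : tensor_eq f (repr (\pi_({eq_quot (tensor_equiv f M)}) s)) s.
  by apply/tensor_piE; rewrite reprK.
move: (repr _) => r; elim=> /= {r s}.
- by [].
- by move=> s t _ ->.
- by move=> s t u _ -> _ ->.
- by move=> s s' t t' _ h _ h'; rewrite !big_cat /= h h'.
- by move=> s t; rewrite !big_cat /= addrC.
- by move=> m; rewrite big_cons !big_nil scale0r addr0.
- by move=> b b' m; rewrite !big_cons !big_nil !addr0 scalerDl.
- by move=> b m m'; rewrite !big_cons !big_nil !addr0 /= raddfD scalerDr.
- by move=> b a m; rewrite !big_cons !big_nil !addr0 /= linearZ /= scalerA.
Qed.

Definition flat (A B : comPzRingType) (f : {rmorphism A -> B}) : Prop :=
  forall (M N : lmodType A) (phi : {linear M -> N}),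
    injective phi -> injective (tensor_map (f := f) phi).

(* Lifting of A-algebra morphisms along surjections with square-zero kernel. *)
Definition formally_smooth (A B : comPzRingType) (f : {rmorphism A -> B}) :
    Prop :=
  forall (C D : comPzRingType) (q : {rmorphism C -> D}),
    (forall d, exists c, q c = d) ->
    (forall c c', q c = 0 -> q c' = 0 -> c * c' = 0) ->
  forall (g : {rmorphism A -> C}) (h : {rmorphism B -> D}),
    h \o f =1 q \o g ->
    exists k : {rmorphism B -> C}, k \o f =1 g /\ q \o k =1 h.

Definition formally_unramified (A B : comPzRingType)
    (f : {rmorphism A -> B}) : Prop :=
  forall (C D : comPzRingType) (q : {rmorphism C -> D}),
    (forall d, exists c, q c = d) ->
    (forall c c', q c = 0 -> q c' = 0 -> c * c' = 0) ->
  forall k k' : {rmorphism B -> C},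
    k \o f =1 k' \o f -> q \o k =1 q \o k' -> k =1 k'.

Definition smooth (A B : comPzRingType) (f : {rmorphism A -> B}) : Prop :=
  finitely_presented f /\ formally_smooth f.

Definition etale (A B : comPzRingType) (f : {rmorphism A -> B}) : Prop :=
  [/\ finitely_presented f, formally_smooth f & formally_unramified f].

(* The objects and arrows of a category fibred in groupoids over affine        *)
(* schemes, with the ring over which an object lives.  Identities and          *)
(* composition are not needed to speak of open immersions.                     *)
Record over_affine := OverAffine {
  oa_obj :> Type;
  oa_hom : oa_obj -> oa_obj -> Type;
  oa_ring : oa_obj -> comPzRingType;
  oa_pull : forall x y, oa_hom x y -> {rmorphism oa_ring y -> oa_ring x} }.

(* An object c over C is a morphism Spec C -> Y, and an arrow x -> c is a      *)
(* factorization of x through it.  So [restricts_to c x J] says that the base  *)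
(* change of c along x : Spec R -> Y has as image the open subscheme D(J) of   *)
(* Spec R.                                                                     *)
Definition restricts_to (Y : over_affine) (c x : Y) (J : oa_ring x -> Prop) :
    Prop :=
  forall (y : Y) (m : oa_hom y x),
    inhabited (oa_hom y c) <-> generates_unit (image_set (oa_pull m) J).

Definition open_immersion (Y : over_affine) (c : Y) : Prop :=
  (forall (x : Y) (m m' : oa_hom x c), m = m') /\
  forall x : Y, exists J : oa_ring x -> Prop, restricts_to c J.

Definition open_affine_cover (Y : over_affine) (I : Type) (c : I -> Y) : Prop :=
  (forall i, open_immersion (c i)) /\
  forall x : Y, field_like (oa_ring x) ->
    exists i, inhabited (oa_hom x (c i)).

(* Schemes are taken as functors of points. *)
Record ring_functor := RingFunctor {
  points :> comPzRingType -> Type;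
  push : forall A B : comPzRingType,
    {rmorphism A -> B} -> points A -> points B;
  push_id : forall (A : comPzRingType) (s : points A),
    push (idfun : {rmorphism A -> A}) s = s;
  push_comp : forall (A B C : comPzRingType) (f : {rmorphism A -> B})
      (g : {rmorphism B -> C}) (s : points A),
    push (g \o f : {rmorphism A -> C}) s = push g (push f s) }.

Record aff (S : ring_functor) := Aff {
  aff_ring :> comPzRingType;
  aff_point : S aff_ring }.

Record aff_hom (S : ring_functor) (U V : aff S) := AffHom {
  pull : {rmorphism V -> U};
  pull_point : push pull (aff_point V) = aff_point U }.

Definition aff_eq (S : ring_functor) (U V : aff S) (f g : aff_hom U V) : Prop :=
  pull f =1 pull g.

Lemma aff_id_subproof (S : ring_functor) (U : aff S) :
  push (idfun : {rmorphism U -> U}) (aff_point U) = aff_point U.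
Proof. exact: push_id. Qed.

Definition aff_id (S : ring_functor) (U : aff S) : aff_hom U U :=
  AffHom (aff_id_subproof U).

Lemma aff_comp_subproof (S : ring_functor) (U V W : aff S)
    (g : aff_hom V W) (f : aff_hom U V) :
  push (pull f \o pull g : {rmorphism W -> U}) (aff_point W) = aff_point U.
Proof. by rewrite push_comp !pull_point. Qed.

Definition aff_comp (S : ring_functor) (U V W : aff S)
    (g : aff_hom V W) (f : aff_hom U V) : aff_hom U W :=
  AffHom (aff_comp_subproof g f).

Definition elements (S : ring_functor) : over_affine :=
  @OverAffine (aff S) (@aff_hom S) (@aff_ring S) (@pull S).

Definition zariski_sheaf (S : ring_functor) : Prop :=
  forall (A : comPzRingType) (n : nat) (a : 'I_n -> A)
    (B : 'I_n -> comPzRingType) (l : forall i, {rmorphism A -> B i}),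
    generates_unit (fun x => exists i, x = a i) ->
    (forall i, is_localization (a i) (l i)) ->
  forall s : forall i, S (B i),
    (forall (i j : 'I_n) (C : comPzRingType) (f : {rmorphism B i -> C})
       (g : {rmorphism B j -> C}),
       f \o l i =1 g \o l j -> push f (s i) = push g (s j)) ->
  exists! t : S A, forall i, push (l i) t = s i.

Definition is_scheme (S : ring_functor) : Prop :=
  zariski_sheaf S /\
  exists (I : Type) (c : I -> elements S), open_affine_cover c.

(* A category over Aff/S, given by its objects over each U in Aff/S, and by    *)
(* its arrows, each of which lies over a morphism of Aff/S.                    *)
Record cat_over (S : ring_functor) := CatOver {
  fib :> aff S -> Type;
  hom : forall U V : aff S, fib U -> fib V -> Type;
  over : forall (U V : aff S) (x : fib U) (y : fib V),
    hom x y -> aff_hom U V;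
  idm : forall (U : aff S) (x : fib U), hom x x;
  compm : forall (U V W : aff S) (x : fib U) (y : fib V) (z : fib W),
    hom y z -> hom x y -> hom x z;
  comp1m : forall (U V : aff S) (x : fib U) (y : fib V) (m : hom x y),
    compm (idm y) m = m;
  compm1 : forall (U V : aff S) (x : fib U) (y : fib V) (m : hom x y),
    compm m (idm x) = m;
  compA : forall (U V W T : aff S) (x : fib U) (y : fib V) (z : fib W)
      (t : fib T) (p : hom z t) (n : hom y z) (m : hom x y),
    compm p (compm n m) = compm (compm p n) m;
  over_id : forall (U : aff S) (x : fib U),
    aff_eq (over (idm x)) (aff_id U);
  over_comp : forall (U V W : aff S) (x : fib U) (y : fib V) (z : fib W)
      (n : hom y z) (m : hom x y),
    aff_eq (over (compm n m)) (aff_comp (over n) (over m)) }.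

Definition fibred_in_groupoids (S : ring_functor) (X : cat_over S) : Prop :=
  (forall (U V : aff S) (f : aff_hom V U) (x : X U),
     exists (y : X V) (m : hom y x), aff_eq (over m) f) /\
  (forall (U V W : aff S) (x : X U) (y : X V) (z : X W)
     (m : hom y x) (n : hom z x) (g : aff_hom W V),
     aff_eq (aff_comp (over m) g) (over n) ->
     exists! k : hom z y, compm m k = n /\ aff_eq (over k) g).

Definition etale_cover (S : ring_functor) (U : aff S) (n : nat)
    (V : 'I_n -> aff S) (f : forall i, aff_hom (V i) U) : Prop :=
  (forall i, etale (pull (f i))) /\ jointly_surjective (fun i => pull (f i)).

(* If h i : x i -> x lies over f i : V i -> U, then x i is the pullback of x,  *)
(* and an isomorphism between the pullbacks of x and y to V i is an arrow      *)
(* x i -> y over f i.                                                          *)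
Definition isom_sheaf (S : ring_functor) (X : cat_over S) : Prop :=
  forall (U : aff S) (x y : X U) (n : nat) (V : 'I_n -> aff S)
    (f : forall i, aff_hom (V i) U), etale_cover f ->
  forall (xi : forall i, X (V i)) (h : forall i, hom (xi i) x)
    (k : forall i, hom (xi i) y),
    (forall i, aff_eq (over (h i)) (f i)) ->
    (forall i, aff_eq (over (k i)) (f i)) ->
    (forall (i j : 'I_n) (W : aff S) (w : X W)
       (a : hom w (xi i)) (b : hom w (xi j)),
       compm (h i) a = compm (h j) b -> compm (k i) a = compm (k j) b) ->
  exists! phi : hom x y,
    aff_eq (over phi) (aff_id U) /\ forall i, compm phi (h i) = k i.

(* The transition isomorphism from the pullback of x i to that of x j over     *)
(* V i x_U V j is encoded by its effect on arrows: for a : W -> V i and        *)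
(* b : W -> V j equal over U, it turns w -> x i over a into w -> x j over b.   *)
Record descent_datum (S : ring_functor) (X : cat_over S) (U : aff S) (n : nat)
    (V : 'I_n -> aff S) (f : forall i, aff_hom (V i) U) := DescentDatum {
  dd_obj : forall i, X (V i);
  dd_trans : forall (i j : 'I_n) (W : aff S) (w : X W)
      (h : hom w (dd_obj i)) (b : aff_hom W (V j)),
    aff_eq (aff_comp (f i) (over h)) (aff_comp (f j) b) -> hom w (dd_obj j);
  dd_over : forall (i j : 'I_n) (W : aff S) (w : X W)
      (h : hom w (dd_obj i)) (b : aff_hom W (V j)) e,
    aff_eq (over (dd_trans (h := h) (b := b) e)) b;
  dd_natural : forall (i j : 'I_n) (W W' : aff S) (w : X W) (w' : X W')
      (h : hom w (dd_obj i)) (b : aff_hom W (V j)) (m : hom w' w) e e',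
    dd_trans (h := compm h m) (b := aff_comp b (over m)) e' =
    compm (dd_trans (h := h) (b := b) e) m;
  dd_cocycle : forall (i j k : 'I_n) (W : aff S) (w : X W)
      (h : hom w (dd_obj i)) (b : aff_hom W (V j)) (c : aff_hom W (V k))
      e e' e'',
    dd_trans (h := dd_trans (h := h) (b := b) e) (b := c) e' =
    dd_trans (h := h) (b := c) e'' }.

Definition effective (S : ring_functor) (X : cat_over S) (U : aff S) (n : nat)
    (V : 'I_n -> aff S) (f : forall i, aff_hom (V i) U)
    (D : descent_datum X f) : Prop :=
  exists (x : X U) (g : forall i, hom (dd_obj D i) x),
    (forall i, aff_eq (over (g i)) (f i)) /\
    forall (i j : 'I_n) (W : aff S) (w : X W)
      (h : hom w (dd_obj D i)) (b : aff_hom W (V j)) e,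
      compm (g j) (dd_trans (h := h) (b := b) e) = compm (g i) h.

Definition is_stack (S : ring_functor) (X : cat_over S) : Prop :=
  [/\ fibred_in_groupoids X, isom_sheaf X &
      forall (U : aff S) (n : nat) (V : 'I_n -> aff S)
        (f : forall i, aff_hom (V i) U), etale_cover f ->
        forall D : descent_datum X f, effective D].

(* By the 2-Yoneda lemma a 1-morphism U -> X is an object of X over U, and     *)
(* given u over U and v over V, a pair of f : U -> V and a 2-morphism          *)
(* u => v f is an arrow u -> v.  A morphism from W to U x_X T is then given by *)
(* an object w over W with arrows w -> u and w -> t.                           *)
Record fprod_obj (S : ring_functor) (X : cat_over S) (U T : aff S) (u : X U)
    (t : X T) := FprodObj {
  fp_base : aff S;
  fp_obj : X fp_base;
  fp_left : hom fp_obj u;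
  fp_right : hom fp_obj t }.

Definition fprod_hom (S : ring_functor) (X : cat_over S) (U T : aff S) (u : X U)
    (t : X T) (a b : fprod_obj u t) : Type :=
  {m : hom (fp_obj a) (fp_obj b) |
    compm (fp_left b) m = fp_left a /\ compm (fp_right b) m = fp_right a}.

Definition fprod (S : ring_functor) (X : cat_over S) (U T : aff S) (u : X U)
    (t : X T) : over_affine :=
  @OverAffine (fprod_obj u t) (@fprod_hom S X U T u t)
    (fun a => fp_base a) (fun a b m => pull (over (sval m))).

Definition fprod_to_right (S : ring_functor) (X : cat_over S) (U T : aff S)
    (u : X U) (t : X T) (a : fprod u t) : {rmorphism T -> oa_ring a} :=
  pull (over (fp_right a)).

(* U x_X T -> T is flat and finitely presented for every T -> X.  If X has     *)
(* affine diagonal, U x_X T is affine over U x_S T, hence a scheme, not        *)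
(* necessarily affine as S is arbitrary.  Finite presentation is local finite  *)
(* presentation, quasi-compactness (the cover is finite) and                   *)
(* quasi-separatedness (c i and c j intersect in a quasi-compact open).        *)
Definition flat_fp (S : ring_functor) (X : cat_over S) (U : aff S) (u : X U) :
    Prop :=
  forall (T : aff S) (t : X T),
  exists (n : nat) (c : 'I_n -> fprod u t),
    [/\ open_affine_cover c,
        forall i, flat (fprod_to_right (c i)) /\
          finitely_presented (fprod_to_right (c i)) &
        forall i j, exists J : seq (oa_ring (c j)),
          restricts_to (c i) (fun a => a \in J)].

Definition smooth_surjective (S : ring_functor) (X : cat_over S) (U : aff S)
    (u : X U) : Prop :=
  forall (T : aff S) (t : X T),
  exists (I : Type) (c : I -> fprod u t),
    [/\ open_affine_cover c,
        forall i, smooth (fprod_to_right (c i)) &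
        jointly_surjective (fun i => fprod_to_right (c i))].

(* For every affine U and (x, y) : U -> X x X, the fibre product of (x, y)     *)
(* with the diagonal, i.e. Isom(x, y), is an affine scheme.                    *)
Definition affine_diagonal (S : ring_functor) (X : cat_over S) : Prop :=
  forall (U : aff S) (x y : X U),
  exists (R : aff S) (r : X R) (h : hom r x) (k : hom r y),
    aff_eq (over h) (over k) /\
    forall (W : aff S) (w : X W) (h' : hom w x) (k' : hom w y),
      aff_eq (over h') (over k') ->
      exists! m : hom w r, compm h m = h' /\ compm k m = k'.

(* The conditions of Laumon and Moret-Bailly for an algebraic stack            *)
(* (representable, separated and quasi-compact diagonal; smooth surjective     *)
(* morphism from an algebraic space) are special cases of the last two.        *)
Definition geometric_stack (S : ring_functor) (X : cat_over S) : Prop :=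
  [/\ is_stack X, affine_diagonal X &
      exists (P : aff S) (p : X P), smooth_surjective p].

Record aff_over (S : ring_functor) (X : cat_over S) := AffOver {
  ao_base : aff S;
  ao_map : X ao_base;
  ao_flat_fp : flat_fp ao_map }.

Definition ao_hom (S : ring_functor) (X : cat_over S) (u v : aff_over X) :
    Type :=
  hom (ao_map u) (ao_map v).

Definition structure_presheaf (S : ring_functor) (X : cat_over S)
    (u : aff_over X) : comPzRingType := ao_base u.

Definition structure_res (S : ring_functor) (X : cat_over S)
    (u v : aff_over X) (m : ao_hom u v) :
    {rmorphism structure_presheaf v -> structure_presheaf u} :=
  pull (over m).

Record module_presheaf (S : ring_functor) (X : cat_over S) := ModulePresheaf {
  sections :> forall u : aff_over X, lmodType (structure_presheaf u);
  res : forall (u v : aff_over X) (m : ao_hom u v),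
    {linear sections v -> sections u | structure_res m \; *:%R};
  res_id : forall (u : aff_over X) (s : sections u),
    res (idm (ao_map u) : ao_hom u u) s = s;
  res_comp : forall (u v w : aff_over X) (n : ao_hom v w) (m : ao_hom u v)
      (s : sections w),
    res (compm n m : ao_hom u w) s = res m (res n s) }.

(* The induced map is O(u)-linear, so it is an isomorphism of modules as soon  *)
(* as it is bijective.                                                         *)
Definition cartesian (S : ring_functor) (X : cat_over S)
    (M : module_presheaf X) : Prop :=
  forall (u v : aff_over X) (m : ao_hom u v),
    bijective (tensor_ind (res M m)).

Definition fppf_cover (S : ring_functor) (X : cat_over S) (v : aff_over X)
    (n : nat) (u : 'I_n -> aff_over X) (f : forall i, ao_hom (u i) v) : Prop :=
  (forall i, flat (structure_res (f i)) /\
    finitely_presented (structure_res (f i))) /\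
  jointly_surjective (fun i => structure_res (f i)).

(* Agreement on all w over u i and u j replaces agreement on the fibre product *)
(* of u i and u j over v.                                                      *)
Definition is_sheaf (S : ring_functor) (X : cat_over S)
    (M : module_presheaf X) : Prop :=
  forall (v : aff_over X) (n : nat) (u : 'I_n -> aff_over X)
    (f : forall i, ao_hom (u i) v), fppf_cover f ->
  forall s : forall i, M (u i),
    (forall (i j : 'I_n) (w : aff_over X) (a : ao_hom w (u i))
       (b : ao_hom w (u j)),
       compm (f i) a = compm (f j) b -> res M a (s i) = res M b (s j)) ->
  exists! t : M v, forall i, res M (f i) t = s i.

(* Main.v *)
(* Fpqc descent for modules, in its fppf form.  Let [M = F v] and let          *)
(* [A -> B_i] be the ring maps of a covering.  If [N] is a submodule of an     *)
(* [A]-module [P] and [s] in [P] is such that [1 (x) s] comes from             *)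
(* [B_i (x) N] for all [i], then [s] is in [N]: by flatness the ideal          *)
(* [{a | a s in N}] generates the unit ideal of each [B_i], and a prime        *)
(* containing it would lift to some [B_i].  Separatedness is the case [N = 0], *)
(* [P = M].  For gluing, [N] is the image of [M] in the product [P] of the     *)
(* modules [F u_i]: compatible sections satisfy the condition since, [F] being *)
(* Cartesian, [B_k (x) F u_i] embeds in the sections over [u_k x_v u_i], where *)
(* [1 (x) s_i] becomes the restriction of [s_k], an element of [B_k (x) M].    *)
(* It remains that [u_k x_v u_i] is flat and finitely presented over [X].      *)

From HB Require Import structures.
From mathcomp Require Import all_boot all_algebra.
From mathcomp Require Import generic_quotient boolp classical_sets.
Require Import Defs.

Set Implicit Arguments.
Unset Strict Implicit.
Unset Printing Implicit Defensive.
Import GRing.Theory.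
Local Open Scope ring_scope.
Local Open Scope quotient_scope.

(** * Tensor products *)

(** A covering of [v] gives finitely many flat ring maps [A -> B_i], jointly surjective on spectra,
    and the Cartesian condition identifies each [F (u i)] with the base change of [F v] to [B_i].
    The sheaf condition is therefore faithfully flat descent of elements of a module. Both halves
    follow from one local criterion, [fppf_local_mem]: membership in a submodule may be tested after
    base change to every [B_i]. It combines [flat_ideal], where flatness controls the ideal of [a]
    with [a *: s] in the submodule, with [exists_prime] and the lifting of primes.

    [cartesian_separated] applies the criterion to the zero submodule, and [cartesian_glue] to the
    image of [F v] in the product of the [F (u i)]. For gluing, the criterion is checked on the
    overlaps of the [u k] and [u i] over [v], which must be objects of the site:
    [exists_fibre_product] constructs them from the groupoid fibration, and [flat_fp_pull] shows
    that they are flat and finitely presented over the stack, since both properties are stable under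
    base change and composition ([flat_base_change], [flat_comp], [fp_base_change], [fp_comp]). *)

Section TensorModule.
Variables (A B : comPzRingType) (f : {rmorphism A -> B}) (M : lmodType A).
Implicit Types (b : B) (m : M) (s t : seq (B * M)) (x y : tensor f M).

Definition tclass s : tensor f M := \pi_({eq_quot (tensor_equiv f M)}) s.

HB.instance Definition _ :=
  Choice.copy (tensor f M) {eq_quot (tensor_equiv f M)}.

Lemma tclassP s t : tensor_eq f s t <-> tclass s = tclass t.
Proof. exact: tensor_piE. Qed.

Lemma tclass_repr x : tclass (repr (x : {eq_quot (tensor_equiv f M)})) = x.
Proof. exact: reprK. Qed.

Lemma tensor_eq_repr s :
  tensor_eq f (repr (tclass s : {eq_quot (tensor_equiv f M)})) s.
Proof. by apply/tclassP; rewrite tclass_repr. Qed.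

Definition tensor_lift_seq (N : zmodType) (beta : B -> M -> N) s : N :=
  \sum_(p <- s) beta p.1 p.2.

(** Evaluated on a chosen representative, so it is meaningful only for [balanced] maps. The target
    is a mere abelian group, which lets it serve for all the comparison maps below. *)
Definition tensor_lift (N : zmodType) (beta : B -> M -> N) x : N :=
  tensor_lift_seq beta (repr (x : {eq_quot (tensor_equiv f M)})).

Definition balanced (N : zmodType) (beta : B -> M -> N) : Prop :=
  [/\ forall b b' m, beta (b + b') m = beta b m + beta b' m,
      forall b m m', beta b (m + m') = beta b m + beta b m' &
      forall b a m, beta (b * f a) m = beta b (a *: m)].

Lemma tensor_lift_class (N : zmodType) (beta : B -> M -> N) s :
  balanced beta -> tensor_lift beta (tclass s) = tensor_lift_seq beta s.
Proof.
case=> hl hr hb; rewrite /tensor_lift.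
move: (tensor_eq_repr s); move: (repr _) => r.
elim=> {r s} //; rewrite /tensor_lift_seq.
- by move=> ? ? ? _ -> _ ->.
- by move=> ? ? ? ? _ h _ h'; rewrite !big_cat /= h h'.
- by move=> ? ?; rewrite !big_cat /= addrC.
- move=> m; rewrite big_seq1 big_nil /=.
  (* [balanced] does not ask that [beta 0 m] vanish; this follows from additivity by
     cancellation. *)
  by apply: (addIr (beta 0 m)); rewrite -hl !add0r.
- by move=> b b' m; rewrite !(big_cons, big_nil) !addr0 /= hl.
- by move=> b m m'; rewrite !(big_cons, big_nil) !addr0 /= hr.
- by move=> b a m; rewrite !big_seq1 /= hb.
Qed.

Definition tensor_nil : tensor f M := tclass [::].
Definition tensor_add x y : tensor f M :=
  tclass (repr (x : {eq_quot (tensor_equiv f M)}) ++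
          repr (y : {eq_quot (tensor_equiv f M)})).

Lemma tclass_cat s t : tclass (s ++ t) = tensor_add (tclass s) (tclass t).
Proof.
by apply/tclassP/tensor_cat; apply: tensor_sym; apply: tensor_eq_repr.
Qed.

Definition tensor_act b s : seq (B * M) := [seq (b * p.1, p.2) | p <- s].

Lemma tensor_act_eq b s t :
  tensor_eq f s t -> tensor_eq f (tensor_act b s) (tensor_act b t).
Proof.
elim=> /= {s t}.
- by move=> s; exact: tensor_refl.
- by move=> s t _; exact: tensor_sym.
- by move=> s t u _ st _; exact: tensor_trans.
- by move=> s s' t t' _ h _ h'; rewrite /tensor_act !map_cat; exact: tensor_cat.
- by move=> s t; rewrite /tensor_act !map_cat; exact: tensor_catC.
- by move=> m; rewrite mulr0; exact: tensor_zero.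
- by move=> c c' m; rewrite mulrDr; exact: tensor_addl.
- by move=> c m m'; exact: tensor_addr.
- by move=> c a m; rewrite mulrA; exact: tensor_balanced.
Qed.

Definition tensor_scale b x : tensor f M :=
  tclass (tensor_act b (repr (x : {eq_quot (tensor_equiv f M)}))).

Lemma tensor_scale_class b s :
  tensor_scale b (tclass s) = tclass (tensor_act b s).
Proof. by apply/tclassP/tensor_act_eq/tensor_eq_repr. Qed.

Lemma tensor_classP x : exists s, x = tclass s.
Proof.
by exists (repr (x : {eq_quot (tensor_equiv f M)})); rewrite tclass_repr.
Qed.

Lemma tensor_addA : associative tensor_add.
Proof.
move=> x y z; have [[[s ->] [t ->]] [u ->]] :=
  (tensor_classP x, tensor_classP y, tensor_classP z).
by rewrite -!tclass_cat catA.
Qed.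

Lemma tensor_addC : commutative tensor_add.
Proof.
move=> x y; have [[s ->] [t ->]] := (tensor_classP x, tensor_classP y).
by rewrite -!tclass_cat; apply/tclassP/tensor_catC.
Qed.

Lemma tensor_add0 : left_id tensor_nil tensor_add.
Proof.
by move=> x; have [s ->] := tensor_classP x; rewrite -tclass_cat.
Qed.

(** Proved on lists, before any group structure: the opposite is scaling by [-1], so the inverse law
    itself comes from this distributivity. *)
Lemma tensor_scaleDl x :
  {morph tensor_scale^~ x : b b' / b + b' >-> tensor_add b b'}.
Proof.
move=> b b' /=; have [s ->] := tensor_classP x.
rewrite !tensor_scale_class; elim: s => [|[c m] s IH].
  by rewrite /= -/tensor_nil tensor_add0.
rewrite /= -!(cat1s _ (tensor_act _ s)) !tclass_cat IH -!tensor_addA.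
rewrite mulrDl (_ : tclass [:: (b * c + b' * c, m)] =
  tensor_add (tclass [:: (b * c, m)]) (tclass [:: (b' * c, m)])); last first.
  by rewrite -tclass_cat; apply/tclassP/tensor_addl.
by rewrite -!tensor_addA; congr tensor_add; rewrite !tensor_addA;
  congr tensor_add; exact: tensor_addC.
Qed.

Lemma tensor_scale0 x : tensor_scale 0 x = tensor_nil.
Proof.
have [s ->] := tensor_classP x; rewrite tensor_scale_class.
elim: s => [//|[c m] s IH]; rewrite /= -cat1s tclass_cat IH mul0r.
rewrite (_ : tclass [:: (0, m)] = tensor_nil) ?tensor_add0 //.
by apply/tclassP/tensor_zero.
Qed.

Lemma tensor_scale1 : left_id 1 tensor_scale.
Proof.
move=> x; have [s ->] := tensor_classP x; rewrite tensor_scale_class.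
by rewrite /tensor_act; congr tclass; elim: s => //= -[c m] s ->; rewrite mul1r.
Qed.

Lemma tensor_addN : left_inverse tensor_nil (tensor_scale (-1)) tensor_add.
Proof.
by move=> x; rewrite -{2}[x]tensor_scale1 -tensor_scaleDl addNr tensor_scale0.
Qed.

HB.instance Definition _ := GRing.isZmodule.Build (tensor f M)
  tensor_addA tensor_addC tensor_add0 tensor_addN.

Lemma tensor_scaleA a b x :
  tensor_scale a (tensor_scale b x) = tensor_scale (a * b) x.
Proof.
have [s ->] := tensor_classP x.
rewrite !tensor_scale_class /tensor_act -map_comp.
by congr tclass; apply: eq_map => p /=; rewrite mulrA.
Qed.

Lemma tensor_scaleDr : right_distributive tensor_scale +%R.
Proof.
move=> b x y; have [[s ->] [t ->]] := (tensor_classP x, tensor_classP y).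
by rewrite -[tclass s + tclass t]tclass_cat !tensor_scale_class -[RHS]tclass_cat
  /tensor_act map_cat.
Qed.

HB.instance Definition _ := GRing.Zmodule_isLmodule.Build B (tensor f M)
  tensor_scaleA tensor_scale1 tensor_scaleDr tensor_scaleDl.

Definition pure b m : tensor f M := tclass [:: (b, m)].

Lemma pureDl b b' m : pure (b + b') m = pure b m + pure b' m.
Proof. by rewrite -[RHS]tclass_cat; apply/tclassP/tensor_addl. Qed.

Lemma pureDr b m m' : pure b (m + m') = pure b m + pure b m'.
Proof. by rewrite -[RHS]tclass_cat; apply/tclassP/tensor_addr. Qed.

Lemma pureZ b a m : pure b (a *: m) = pure (b * f a) m.
Proof. by apply/esym/tclassP/tensor_balanced. Qed.

Lemma scale_pure c b m : c *: pure b m = pure (c * b) m.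
Proof. by rewrite [LHS]tensor_scale_class. Qed.

Lemma pure0 b : pure b 0 = 0.
Proof. by apply: (addIr (pure b 0)); rewrite -pureDr !add0r. Qed.

Lemma tclassE s : tclass s = \sum_(p <- s) pure p.1 p.2.
Proof.
elim: s => [|[b m] s IH]; first by rewrite big_nil.
by rewrite -cat1s tclass_cat big_cons IH.
Qed.

Lemma tensor_elim (P : tensor f M -> Prop) :
  P 0 -> (forall b m, P (pure b m)) -> (forall x y, P x -> P y -> P (x + y)) ->
  forall x, P x.
Proof.
move=> P0 Pp PD x; have [s ->] := tensor_classP x; rewrite tclassE.
by elim/big_rec: _ => // p y _; apply: PD.
Qed.

Lemma tensor_sumP x : exists s, x = \sum_(p <- s) pure p.1 p.2.
Proof. by have [s ->] := tensor_classP x; exists s; rewrite tclassE. Qed.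

Section Lift.
Variables (N : zmodType) (beta : B -> M -> N).
Hypothesis beta_bal : balanced beta.

Lemma tensor_lift_pure b m : tensor_lift beta (pure b m) = beta b m.
Proof. by rewrite tensor_lift_class // /tensor_lift_seq big_seq1. Qed.

Lemma tensor_lift0 : tensor_lift beta 0 = 0.
Proof. by rewrite [LHS]tensor_lift_class // /tensor_lift_seq big_nil. Qed.

Lemma tensor_liftD x y :
  tensor_lift beta (x + y) = tensor_lift beta x + tensor_lift beta y.
Proof.
have [[s ->] [t ->]] := (tensor_classP x, tensor_classP y).
rewrite -[tclass s + tclass t]tclass_cat !tensor_lift_class //.
by rewrite /tensor_lift_seq big_cat.
Qed.

End Lift.

End TensorModule.
Arguments pure {A B} f {M} b m.

Section TensorMaps.
Variables (A B : comPzRingType) (f : {rmorphism A -> B}).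

Lemma tensor_map_pure (M N : lmodType A) (phi : {linear M -> N}) b m :
  tensor_map phi (pure f b m) = pure f b (phi m).
Proof. exact: tensor_map_pi. Qed.

Lemma tensor_map_is_linear (M N : lmodType A) (phi : {linear M -> N}) :
  linear (tensor_map (f := f) phi).
Proof.
move=> b x y; have [[s ->] [t ->]] := (tensor_classP x, tensor_classP y).
rewrite [b *: _]tensor_scale_class -[_ + _]tclass_cat.
rewrite [LHS]tensor_map_pi map_cat [LHS]tclass_cat; congr (_ + _); last first.
  by rewrite [RHS]tensor_map_pi.
rewrite [tensor_map _ _]tensor_map_pi [RHS]tensor_scale_class.
by rewrite /tensor_act -!map_comp.
Qed.

HB.instance Definition _ (M N : lmodType A) (phi : {linear M -> N}) :=
  GRing.isLinear.Build B (tensor f M) (tensor f N) *:%R (tensor_map phi)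
    (tensor_map_is_linear phi).

Lemma tensor_mapD (M N : lmodType A) (phi : {linear M -> N}) :
  {morph tensor_map (f := f) phi : x y / x + y}.
Proof. exact: raddfD. Qed.

Lemma tensor_map0 (M N : lmodType A) (phi : {linear M -> N}) :
  tensor_map (f := f) phi 0 = 0.
Proof. exact: raddf0. Qed.

Variables (M : lmodType A) (N : lmodType B).
Variable phi : {linear M -> N | f \; *:%R}.

Lemma tensor_ind_pure b m : tensor_ind phi (pure f b m) = b *: phi m.
Proof. by rewrite [LHS]tensor_ind_pi big_seq1. Qed.

Lemma tensor_ind0 : tensor_ind phi 0 = 0.
Proof. by rewrite [LHS](tensor_ind_pi phi [::]) big_nil. Qed.

Lemma tensor_indD x y :
  tensor_ind phi (x + y) = tensor_ind phi x + tensor_ind phi y.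
Proof.
have [[s ->] [t ->]] := (tensor_classP x, tensor_classP y).
by rewrite -[tclass f s + _]tclass_cat !tensor_ind_pi big_cat.
Qed.

End TensorMaps.

(** * Restriction of scalars and pushouts of commutative rings *)

Definition restrict (A C : comPzRingType) (g : {rmorphism A -> C})
  (M : lmodType C) : Type := M.

Section Restrict.
Variables (A C : comPzRingType) (g : {rmorphism A -> C}) (M : lmodType C).

HB.instance Definition _ := GRing.Zmodule.copy (restrict g M) M.

Definition restrict_scale (a : A) (m : restrict g M) : restrict g M :=
  g a *: (m : M).

Lemma restrict_scaleA a b m :
  restrict_scale a (restrict_scale b m) = restrict_scale (a * b) m.
Proof. by rewrite /restrict_scale scalerA rmorphM. Qed.

Lemma restrict_scale1 : left_id 1 restrict_scale.
Proof. by move=> m; rewrite /restrict_scale rmorph1 scale1r. Qed.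

Lemma restrict_scaleDr : right_distributive restrict_scale +%R.
Proof. by move=> a m n; rewrite /restrict_scale scalerDr. Qed.

Lemma restrict_scaleDl m : {morph restrict_scale^~ m : a b / a + b}.
Proof. by move=> a b; rewrite /restrict_scale rmorphD scalerDl. Qed.

HB.instance Definition _ := GRing.Zmodule_isLmodule.Build A (restrict g M)
  restrict_scaleA restrict_scale1 restrict_scaleDr restrict_scaleDl.

Lemma restrictZ a (m : restrict g M) : a *: m = g a *: (m : M) :> M.
Proof. by []. Qed.

End Restrict.

Section RestrictMap.
Variables (A C : comPzRingType) (g : {rmorphism A -> C}) (M N : lmodType C).
Variable phi : {linear M -> N}.

Definition restrict_map (m : restrict g M) : restrict g N := phi m.

Lemma restrict_map_is_linear : linear restrict_map.
Proof. by move=> a m n; rewrite /restrict_map /= restrictZ linearP. Qed.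

HB.instance Definition _ := GRing.isLinear.Build A (restrict g M)
  (restrict g N) *:%R restrict_map restrict_map_is_linear.

End RestrictMap.

Section Pushout.
Variables (A B C : comPzRingType).
Variables (f : {rmorphism A -> B}) (g : {rmorphism A -> C}).

Definition pushout : Type := tensor f (restrict g C^o).

HB.instance Definition _ := GRing.Zmodule.on pushout.

Definition ppure (b : B) (c : C) : pushout := pure f (M := restrict g C^o) b c.

Lemma ppureDl b b' c : ppure (b + b') c = ppure b c + ppure b' c.
Proof. exact: pureDl. Qed.

Lemma ppureDr b c c' : ppure b (c + c') = ppure b c + ppure b c'.
Proof. exact: pureDr. Qed.

Lemma ppureZ b a c : ppure b (g a * c) = ppure (b * f a) c.
Proof. exact: pureZ. Qed.

Lemma pushout_elim (P : pushout -> Prop) :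
  P 0 -> (forall b c, P (ppure b c)) ->
  (forall x y, P x -> P y -> P (x + y)) -> forall x, P x.
Proof. exact: (@tensor_elim _ _ f (restrict g C^o)). Qed.

(** Multiplication by the pure tensor of [b] and [c]. [pushout_mul] then extends it additively in
    the first factor, so that the bilinear product is obtained by two successive lifts. *)
Definition pushout_act (b : B) (c : C) : pushout -> pushout :=
  tensor_lift (M := restrict g C^o) (fun b' c' => ppure (b * b') (c * c')).

Lemma pushout_act_balanced b c :
  balanced f (M := restrict g C^o) (fun b' c' => ppure (b * b') (c * c')).
Proof.
split=> [x x' y|x y y'|x a y]; first by rewrite mulrDr ppureDl.
  by rewrite mulrDr ppureDr.
have -> : c * (a *: y) = g a * (c * y) by exact: mulrCA.
by rewrite ppureZ mulrA.
Qed.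

Lemma pushout_actD b c : {morph pushout_act b c : x y / x + y}.
Proof. exact: (tensor_liftD (pushout_act_balanced b c)). Qed.

Lemma pushout_act_pure b c b' c' :
  pushout_act b c (ppure b' c') = ppure (b * b') (c * c').
Proof. exact: (tensor_lift_pure (pushout_act_balanced b c)). Qed.

Lemma pushout_act0 b c : pushout_act b c 0 = 0.
Proof. exact: (tensor_lift0 (pushout_act_balanced b c)). Qed.

Definition pushout_mul (x y : pushout) : pushout :=
  tensor_lift (M := restrict g C^o) (fun b c => pushout_act b c y) x.

Lemma pushout_mul_balanced y :
  balanced f (M := restrict g C^o) (fun b c => pushout_act b c y).
Proof.
split=> [b b' c|b c c'|b a c]; elim/pushout_elim: y => [|x z|x y hx hy].
- by rewrite !pushout_act0 addr0.
- by rewrite !pushout_act_pure mulrDl ppureDl.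
- by rewrite !pushout_actD hx hy addrACA.
- by rewrite !pushout_act0 addr0.
- by rewrite !pushout_act_pure mulrDl ppureDr.
- by rewrite !pushout_actD hx hy addrACA.
- by rewrite !pushout_act0.
- rewrite !pushout_act_pure; have -> : (a *: c) * z = g a * (c * z).
    by rewrite mulrA.
  by rewrite ppureZ mulrAC.
- by rewrite !pushout_actD hx hy.
Qed.

Lemma pushout_mul_pure b c y : pushout_mul (ppure b c) y = pushout_act b c y.
Proof. exact: (tensor_lift_pure (pushout_mul_balanced y)). Qed.

Lemma pushout_mul0 y : pushout_mul 0 y = 0.
Proof. exact: (tensor_lift0 (pushout_mul_balanced y)). Qed.

Lemma pushout_mulDl : left_distributive pushout_mul +%R.
Proof. move=> x x' y; exact: (tensor_liftD (pushout_mul_balanced y)). Qed.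

Lemma pushout_mulC : commutative pushout_mul.
Proof.
(* Only additivity in the left factor is built in; its right-hand counterpart is needed for
   induction on both factors. *)
have mulr0 x : pushout_mul x 0 = 0.
  elim/pushout_elim: x => [|b c|x y hx hy]; first by rewrite pushout_mul0.
    by rewrite pushout_mul_pure pushout_act0.
  by rewrite pushout_mulDl hx hy addr0.
have mulrD x y z : pushout_mul x (y + z) = pushout_mul x y + pushout_mul x z.
  elim/pushout_elim: x => [|b c|x x' hx hx'].
  - by rewrite !pushout_mul0 addr0.
  - by rewrite !pushout_mul_pure pushout_actD.
  - by rewrite !pushout_mulDl hx hx' addrACA.
move=> x y; elim/pushout_elim: x => [|b c|x x' hx hx'].
- by rewrite pushout_mul0 mulr0.
- elim/pushout_elim: y => [|b' c'|y y' hy hy'].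
  + by rewrite pushout_mul0 mulr0.
  + by rewrite !pushout_mul_pure !pushout_act_pure mulrC [c * c']mulrC.
  + by rewrite mulrD pushout_mulDl hy hy'.
- by rewrite mulrD pushout_mulDl hx hx'.
Qed.

Lemma pushout_mulA : associative pushout_mul.
Proof.
have act_mul b c y z : pushout_act b c (pushout_mul y z) =
    pushout_mul (pushout_act b c y) z.
  elim/pushout_elim: y => [|b' c'|y y' hy hy'].
  - by rewrite pushout_mul0 !pushout_act0 pushout_mul0.
  - rewrite pushout_act_pure !pushout_mul_pure.
    elim/pushout_elim: z => [|b'' c''|z z' hz hz'].
    + by rewrite !pushout_act0.
    + by rewrite !pushout_act_pure !mulrA.
    + by rewrite !pushout_actD hz hz'.
  - by rewrite pushout_mulDl !pushout_actD pushout_mulDl hy hy'.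
move=> x y z; elim/pushout_elim: x => [|b c|x x' hx hx'].
- by rewrite !pushout_mul0.
- by rewrite !pushout_mul_pure act_mul.
- by rewrite !pushout_mulDl hx hx'.
Qed.

Lemma pushout_mul1 : left_id (ppure 1 1) pushout_mul.
Proof.
move=> x; rewrite pushout_mul_pure.
elim/pushout_elim: x => [|b c|x y hx hy]; first by rewrite pushout_act0.
  by rewrite pushout_act_pure !mul1r.
by rewrite pushout_actD hx hy.
Qed.

HB.instance Definition _ := GRing.Zmodule_isComPzRing.Build pushout
  pushout_mulA pushout_mulC pushout_mul1 pushout_mulDl.

Lemma ppureM b c b' c' : ppure b c * ppure b' c' = ppure (b * b') (c * c').
Proof. by rewrite [LHS]pushout_mul_pure pushout_act_pure. Qed.

Definition inpl (b : B) : pushout := ppure b 1.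
Definition inpr (c : C) : pushout := ppure 1 c.

Lemma inpl_is_zmod_morphism : zmod_morphism inpl.
Proof.
move=> b b'; apply: (addIr (inpl b')).
by rewrite -[LHS]ppureDl !subrK.
Qed.

Lemma inpl_is_monoid_morphism : monoid_morphism inpl.
Proof. by split=> // b b'; rewrite /inpl ppureM mulr1. Qed.

HB.instance Definition _ := GRing.isZmodMorphism.Build B pushout inpl
  inpl_is_zmod_morphism.
HB.instance Definition _ := GRing.isMonoidMorphism.Build B pushout inpl
  inpl_is_monoid_morphism.

Lemma inpr_is_zmod_morphism : zmod_morphism inpr.
Proof.
move=> b b'; apply: (addIr (inpr b')).
by rewrite -[LHS]ppureDr !subrK.
Qed.

Lemma inpr_is_monoid_morphism : monoid_morphism inpr.
Proof. by split=> // b b'; rewrite /inpr ppureM mulr1. Qed.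

HB.instance Definition _ := GRing.isZmodMorphism.Build C pushout inpr
  inpr_is_zmod_morphism.
HB.instance Definition _ := GRing.isMonoidMorphism.Build C pushout inpr
  inpr_is_monoid_morphism.

Lemma ppureE b c : ppure b c = inpl b * inpr c.
Proof. by rewrite ppureM mulr1 mul1r. Qed.

Lemma pushout_comm : inpl \o f =1 inpr \o g.
Proof. by move=> a; rewrite /= /inpl /inpr -[g a]mulr1 ppureZ mul1r. Qed.

Lemma pushout_ext (D : comPzRingType) (k k' : {rmorphism pushout -> D}) :
  k \o inpl =1 k' \o inpl -> k \o inpr =1 k' \o inpr -> k =1 k'.
Proof.
move=> hl hr; elim/pushout_elim=> [|b c|x y hx hy].
- by rewrite !rmorph0.
- by rewrite ppureE !rmorphM; congr (_ * _); [apply: hl|apply: hr].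
- by rewrite !rmorphD hx hy.
Qed.

(** The map sends the tensor of [b] and [c] to [u b * v c]; agreement of [u] and [v] on [A] is
    exactly what makes this balanced. *)
Lemma pushout_univ (D : comPzRingType) (u : {rmorphism B -> D})
    (v : {rmorphism C -> D}) : u \o f =1 v \o g ->
  exists k : {rmorphism pushout -> D}, k \o inpl =1 u /\ k \o inpr =1 v.
Proof.
move=> uv.
have bal : balanced f (M := restrict g C^o) (fun b c => u b * v c).
  split=> [b b' c|b c c'|b a c]; first by rewrite rmorphD mulrDl.
    by rewrite rmorphD mulrDr.
  rewrite restrictZ !rmorphM /= -mulrA; congr (_ * (_ * _)); exact: uv.
pose k : pushout -> D :=
  tensor_lift (M := restrict g C^o) (fun b c => u b * v c).
have kD : {morph k : x y / x + y} by exact: (tensor_liftD bal).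
have kp b c : k (ppure b c) = u b * v c by exact: (tensor_lift_pure bal).
have k0 : k 0 = 0 by exact: (tensor_lift0 bal).
have kB : zmod_morphism k.
  by move=> x y; apply: (addIr (k y)); rewrite -kD !subrK.
have kM : monoid_morphism k.
  split=> [|x y]; first by rewrite kp !rmorph1 mulr1.
  elim/pushout_elim: x => [|b c|x x' hx hx'].
  - by rewrite mul0r k0 mul0r.
  - elim/pushout_elim: y => [|b' c'|y y' hy hy'].
    + by rewrite mulr0 k0 mulr0.
    + by rewrite ppureM !kp !rmorphM mulrACA.
    + by rewrite mulrDr !kD hy hy' mulrDr.
  - by rewrite mulrDl !kD hx hx' mulrDl.
pose kr : {rmorphism pushout -> D} := HB.pack k
  (GRing.isZmodMorphism.Build _ _ k kB) (GRing.isMonoidMorphism.Build _ _ k kM).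
exists kr; split=> x /=; first by rewrite [LHS]kp rmorph1 mulr1.
by rewrite [LHS]kp rmorph1 mul1r.
Qed.

End Pushout.

(** * Flatness *)

Section PushoutTensor.
Variables (A B C : comPzRingType).
Variables (f : {rmorphism A -> B}) (g : {rmorphism A -> C}).
Notation p1 := (inpl f g : {rmorphism B -> pushout f g}).
Notation p2 := (inpr f g : {rmorphism C -> pushout f g}).

Section Cancel.
Variable M : lmodType C.

(** With [m] fixed, this is half of the cancellation of [C] in the tensor product of [pushout f g]
    and [M] over [C], which is [B] tensor [M] over [A]; [cancel_tensor] lets [m] vary. *)
Definition cancel_pure (m : M) : pushout f g -> tensor f (restrict g M) :=
  tensor_lift (M := restrict g C^o)
    (fun b (c : C) => pure f (M := restrict g M) b (c *: m)).

Lemma cancel_pure_balanced m : balanced f (M := restrict g C^o)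
  (fun b (c : C) => pure f (M := restrict g M) b (c *: m)).
Proof.
split=> [b b' c|b c c'|b a c]; first by rewrite pureDl.
  by rewrite scalerDl -[RHS]pureDr.
by rewrite -pureZ; congr pure; rewrite restrictZ scalerA.
Qed.

Lemma cancel_pure_ppure m b c :
  cancel_pure m (ppure f g b c) = pure f (M := restrict g M) b (c *: m).
Proof. exact: (tensor_lift_pure (cancel_pure_balanced m)). Qed.

Lemma cancel_pureD m : {morph cancel_pure m : x y / x + y}.
Proof. exact: (tensor_liftD (cancel_pure_balanced m)). Qed.

Lemma cancel_pure0 m : cancel_pure m 0 = 0.
Proof. exact: (tensor_lift0 (cancel_pure_balanced m)). Qed.

Definition cancel_tensor : tensor p2 M -> tensor f (restrict g M) :=
  tensor_lift (fun t m => cancel_pure m t).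

Lemma cancel_balanced : balanced p2 (fun t m => cancel_pure m t).
Proof.
split=> [t t' m|t m m'|t c m]; first exact: cancel_pureD.
  elim/pushout_elim: t => [|b c|x y hx hy].
  - by rewrite !cancel_pure0 addr0.
  - by rewrite !cancel_pure_ppure scalerDr -[RHS]pureDr.
  - by rewrite !cancel_pureD hx hy addrACA.
elim/pushout_elim: t => [|b c'|x y hx hy].
- by rewrite mul0r !cancel_pure0.
- by rewrite ppureM !cancel_pure_ppure mulr1 scalerA.
- by rewrite mulrDl !cancel_pureD hx hy.
Qed.

Lemma cancel_tensor_pure t m : cancel_tensor (pure p2 t m) = cancel_pure m t.
Proof. exact: (tensor_lift_pure cancel_balanced). Qed.

Lemma cancel_tensorD : {morph cancel_tensor : x y / x + y}.
Proof. exact: (tensor_liftD cancel_balanced). Qed.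

Lemma cancel_tensor0 : cancel_tensor 0 = 0.
Proof. exact: (tensor_lift0 cancel_balanced). Qed.

Definition expand_tensor : tensor f (restrict g M) -> tensor p2 M :=
  tensor_lift (M := restrict g M) (fun b m => pure p2 (M := M) (p1 b) m).

Lemma expand_balanced : balanced f (M := restrict g M)
  (fun b m => pure p2 (M := M) (p1 b) m).
Proof.
split=> [b b' m|b m m'|b a m]; first by rewrite rmorphD pureDl.
  exact: pureDr.
rewrite restrictZ pureZ rmorphM; congr (pure _ (_ * _) _).
exact: pushout_comm.
Qed.

Lemma expand_tensor_pure b m :
  expand_tensor (pure f (M := restrict g M) b m) = pure p2 (p1 b) m.
Proof. exact: (tensor_lift_pure expand_balanced). Qed.

Lemma expand_tensorD : {morph expand_tensor : x y / x + y}.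
Proof. exact: (tensor_liftD expand_balanced). Qed.

Lemma expand_tensor0 : expand_tensor 0 = 0.
Proof. exact: (tensor_lift0 expand_balanced). Qed.

Lemma cancel_tensorK : cancel cancel_tensor expand_tensor.
Proof.
elim/tensor_elim=> [|t m|x y hx hy].
- by rewrite cancel_tensor0 expand_tensor0.
- rewrite cancel_tensor_pure; elim/pushout_elim: t => [|b c|x y hx hy].
  + rewrite cancel_pure0 expand_tensor0 -(scale0r (pure p2 0 m)).
    by rewrite scale_pure mul0r.
  + by rewrite cancel_pure_ppure expand_tensor_pure pureZ -ppureE.
  + by rewrite cancel_pureD expand_tensorD hx hy pureDl.
- by rewrite cancel_tensorD expand_tensorD hx hy.
Qed.

Lemma expand_tensorK : cancel expand_tensor cancel_tensor.
Proof.
elim/tensor_elim=> [|b m|x y hx hy].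
- by rewrite expand_tensor0 cancel_tensor0.
- by rewrite expand_tensor_pure cancel_tensor_pure cancel_pure_ppure scale1r.
- by rewrite expand_tensorD cancel_tensorD hx hy.
Qed.

End Cancel.

Lemma expand_tensor_natural (M N : lmodType C) (phi : {linear M -> N}) x :
  tensor_map phi (expand_tensor x) =
  expand_tensor (tensor_map (M := restrict g M) (N := restrict g N)
    (restrict_map phi) x).
Proof.
elim/tensor_elim: x => [|b m|x y hx hy].
- by rewrite tensor_map0 !expand_tensor0 tensor_map0.
- by rewrite expand_tensor_pure !tensor_map_pure expand_tensor_pure.
- by rewrite expand_tensorD !tensor_mapD expand_tensorD hx hy.
Qed.

(** By the natural isomorphism [expand_tensor], tensoring a [C]-module along [p2] amounts to
    tensoring its restriction along [f], and restriction keeps injections injective. *)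
Lemma flat_base_change : flat f -> flat p2.
Proof.
move=> f_flat M N phi phi_inj x y.
rewrite -[x]cancel_tensorK -[y]cancel_tensorK !expand_tensor_natural.
move/(can_inj (@expand_tensorK N)).
by move/(f_flat (restrict g M) (restrict g N) (restrict_map phi) phi_inj) ->.
Qed.

End PushoutTensor.

Section TensorComp.
Variables (A B C : comPzRingType).
Variables (f : {rmorphism A -> B}) (g : {rmorphism B -> C}).
Notation gf := (g \o f : {rmorphism A -> C}).

Section Assoc.
Variable M : lmodType A.

Definition nest_tensor : tensor gf M -> tensor g (tensor f M) :=
  tensor_lift (fun c m => pure g c (pure f 1 m)).

Lemma nest_balanced : balanced gf (M := M) (fun c m => pure g c (pure f 1 m)).
Proof.
split=> [c c' m|c m m'|c a m]; first exact: pureDl.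
  by rewrite !pureDr.
by rewrite [pure f 1 (a *: m)]pureZ [1 * _]mulrC -(@scale_pure _ _ f) pureZ.
Qed.

Lemma nest_tensor_pure c m :
  nest_tensor (pure gf c m) = pure g c (pure f 1 m).
Proof. exact: (tensor_lift_pure nest_balanced). Qed.

Lemma nest_tensorD : {morph nest_tensor : x y / x + y}.
Proof. exact: (tensor_liftD nest_balanced). Qed.

Lemma nest_tensor0 : nest_tensor 0 = 0.
Proof. exact: (tensor_lift0 nest_balanced). Qed.

Definition flatten_pure (c : C) : tensor f M -> tensor gf M :=
  tensor_lift (fun b m => pure gf (c * g b) m).

Lemma flatten_pure_balanced c :
  balanced f (fun b m => pure gf (M := M) (c * g b) m).
Proof.
split=> [b b' m|b m m'|b a m]; first by rewrite rmorphD mulrDr pureDl.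
  exact: pureDr.
by rewrite pureZ rmorphM mulrA.
Qed.

Lemma flatten_pure_pure c b m :
  flatten_pure c (pure f b m) = pure gf (c * g b) m.
Proof. exact: (tensor_lift_pure (flatten_pure_balanced c)). Qed.

Lemma flatten_pureD c : {morph flatten_pure c : x y / x + y}.
Proof. exact: (tensor_liftD (flatten_pure_balanced c)). Qed.

Lemma flatten_pure0 c : flatten_pure c 0 = 0.
Proof. exact: (tensor_lift0 (flatten_pure_balanced c)). Qed.

Definition flatten_tensor : tensor g (tensor f M) -> tensor gf M :=
  tensor_lift flatten_pure.

Lemma flatten_balanced : balanced g flatten_pure.
Proof.
split=> [c c' x|c x x'|c b x]; last 2 first.
- exact: flatten_pureD.
- elim/tensor_elim: x => [|b' m|x y hx hy].
  + by rewrite scaler0 !flatten_pure0.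
  + by rewrite scale_pure !flatten_pure_pure rmorphM mulrA.
  + by rewrite scalerDr !flatten_pureD hx hy.
elim/tensor_elim: x => [|b m|x y hx hy].
- by rewrite !flatten_pure0 addr0.
- by rewrite !flatten_pure_pure mulrDl pureDl.
- by rewrite !flatten_pureD hx hy addrACA.
Qed.

Lemma flatten_tensor_pure c x :
  flatten_tensor (pure g c x) = flatten_pure c x.
Proof. exact: (tensor_lift_pure flatten_balanced). Qed.

Lemma flatten_tensorD : {morph flatten_tensor : x y / x + y}.
Proof. exact: (tensor_liftD flatten_balanced). Qed.

Lemma flatten_tensor0 : flatten_tensor 0 = 0.
Proof. exact: (tensor_lift0 flatten_balanced). Qed.

Lemma nest_tensorK : cancel nest_tensor flatten_tensor.
Proof.
elim/tensor_elim=> [|c m|x y hx hy].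
- by rewrite nest_tensor0 flatten_tensor0.
- rewrite nest_tensor_pure flatten_tensor_pure flatten_pure_pure.
  by rewrite rmorph1 mulr1.
- by rewrite nest_tensorD flatten_tensorD hx hy.
Qed.

End Assoc.

Lemma nest_tensor_natural (M N : lmodType A) (phi : {linear M -> N}) x :
  nest_tensor (tensor_map (f := gf) phi x) =
  tensor_map (tensor_map (f := f) phi) (nest_tensor x).
Proof.
elim/tensor_elim: x => [|c m|x y hx hy].
- by rewrite tensor_map0 !nest_tensor0 tensor_map0.
- rewrite tensor_map_pure !nest_tensor_pure tensor_map_pure /=.
  by rewrite tensor_map_pure.
- by rewrite tensor_mapD !nest_tensorD tensor_mapD hx hy.
Qed.

(** [nest_tensor] is natural and has a left inverse, so injectivity may be checked after tensoring
    along [f] and then along [g]. *)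
Lemma flat_comp : flat f -> flat g -> flat gf.
Proof.
move=> f_flat g_flat M N phi phi_inj x y xy.
apply: (can_inj (@nest_tensorK M)).
apply: (g_flat _ _ (tensor_map (f := f) phi)).
  exact: (f_flat _ _ phi phi_inj).
by rewrite -!nest_tensor_natural xy.
Qed.

End TensorComp.

(** * Submodules and the fppf-local test for membership *)

Section Submodule.
Variables (A : comPzRingType) (M : lmodType A).

(** Membership is an arbitrary proposition, made boolean classically in [submod_pred] so that
    [submod_type] is a module to which flatness applies. Over [A^o] these are the ideals of [A]. *)
Record submod := Submod {
  submod_mem :> M -> Prop;
  submod0 : submod_mem 0;
  submodD : forall x y, submod_mem x -> submod_mem y -> submod_mem (x + y);
  submodZ : forall a x, submod_mem x -> submod_mem (a *: x) }.

Variable S : submod.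

Lemma submodB x y : S x -> S y -> S (x - y).
Proof. by move=> Sx Sy; rewrite -scaleN1r; apply/submodD/submodZ. Qed.

Definition submod_pred : pred M := fun x => `[< S x >].

Record submod_type : Type :=
  SubmodType { submod_val : M; submod_valP : submod_pred submod_val }.

HB.instance Definition _ := [isSub for submod_val].
HB.instance Definition _ := [Choice of submod_type by <:].

Lemma submod_pred_closed : submod_closed submod_pred.
Proof.
split=> [|a x y]; first by apply/asboolP/submod0.
by move=> /asboolP Sx /asboolP Sy; apply/asboolP/submodD => //; apply: submodZ.
Qed.

HB.instance Definition _ := GRing.SubChoice_isSubLmodule.Build A M submod_pred
  submod_type submod_pred_closed.

End Submodule.

Section FlatIdeal.
Variables (A B : comPzRingType) (f : {rmorphism A -> B}).
Variables (M : lmodType A) (N : submod M) (s : M).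

(** This is [N + A s]; the coefficient [a] of [s] is determined only up to elements that multiply
    [s] into [N]. *)
Definition submod_adjoin : submod M.
Proof.
apply: (@Submod A M (fun x => exists a, N (x - a *: s))).
- by exists 0; rewrite scale0r subr0; apply: submod0.
- move=> x y [a ha] [b hb]; exists (a + b).
  by rewrite scalerDl opprD addrACA; apply: submodD.
- move=> c x [a ha]; exists (c * a).
  by rewrite -scalerA -scalerBr; apply: submodZ.
Defined.

(* Flatness moves the relation into [N + A s], on which [n + a s |-> a] is     *)
(* well defined modulo the annihilator of [s] in [M / N].                      *)
Lemma flat_ideal (t : seq (B * M)) (Q : submod B^o) : flat f ->
  pure f 1 s = \sum_(p <- t) pure f p.1 p.2 -> (forall p, p \in t -> N p.2) ->
  (forall a, N (a *: s) -> Q (f a)) -> Q 1.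
Proof.
move=> f_flat st tN QN.
pose N' := submod_type submod_adjoin.
have adj_s : submod_adjoin s by exists 1; rewrite scale1r subrr; apply: submod0.
have adj_N x : N x -> submod_adjoin x by exists 0; rewrite scale0r subr0.
pose s' : N' := SubmodType (asboolT adj_s).
have [t' tt' t'N] : exists2 t' : seq (B * N'),
    t = [seq (p.1, val p.2) | p <- t'] & forall p, p \in t' -> N (val p.2).
  elim: t tN {st} => [|[b m] t IH] tN; first by exists [::].
  have [|t' -> t'N] := IH; first by move=> p pt; apply: tN; rewrite inE pt orbT.
  have Nm : N m by apply: (tN (b, m)); rewrite inE eqxx.
  exists ((b, SubmodType (asboolT (adj_N _ Nm))) :: t') => // p.
  by rewrite inE => /orP[/eqP -> //|/t'N].
(* Flatness enters here: the relation holds in the base change of [M], hence already in that of the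
   submodule [N']. *)
have s't' : pure f 1 s' = \sum_(p <- t') pure f p.1 p.2.
  apply: (f_flat N' M (val : {linear N' -> M})); first exact: val_inj.
  rewrite tensor_map_pure st tt' big_map.
  rewrite raddf_sum; by apply: eq_bigr => p _ /=; rewrite tensor_map_pure.
(* [alpha] chooses a coefficient of [s]. It need not be linear, but its defects multiply [s] into
   [N], so [f] sends them into [Q]. *)
have /choice[alpha alphaP] (x : N') : exists a, N (val x - a *: s).
  by have /asboolP := valP x.
have alphaQ (x : N') a : N (val x - a *: s) -> Q (f a - f (alpha x)).
  move=> Nx; rewrite -rmorphB; apply: QN; rewrite scalerBl.
  have -> : a *: s - alpha x *: s = (val x - alpha x *: s) - (val x - a *: s).
    by rewrite opprB [RHS]addrC addrA subrK.
  exact: submodB.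
have QM b c : Q c -> Q (b * c) by exact: (submodZ (s := Q)).
(* Consequently the sum of [b * f (alpha x)] depends, modulo [Q], only on the tensor represented;
   this is checked on each generator of the congruence. *)
have tQ u v : tensor_eq f u v ->
    Q (\sum_(p <- u) p.1 * f (alpha p.2) - \sum_(p <- v) p.1 * f (alpha p.2)).
  elim=> {u v}.
  - by move=> u; rewrite subrr; apply: submod0.
  - move=> u v _ h; rewrite -opprB -[- _]sub0r.
    by apply: submodB => //; apply: submod0.
  - move=> u v w _ h _ h'.
    rewrite -(subrKA (\sum_(p <- v) p.1 * f (alpha p.2))).
    exact: submodD.
  - move=> u u' v v' _ h _ h'; rewrite !big_cat opprD addrACA.
    exact: submodD.
  - by move=> u v; rewrite !big_cat /= [X in X - _]addrC subrr; apply: submod0.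
  - by move=> x; rewrite big_seq1 big_nil mul0r subr0; apply: submod0.
  - move=> b b' x; rewrite !(big_cons, big_nil) /= !addr0 mulrDl subrr.
    exact: submod0.
  - move=> b x y; rewrite !(big_cons, big_nil) /= !addr0 -mulrDr -mulrBr.
    apply: QM; rewrite -opprB -[- _]sub0r; apply: submodB; first exact: submod0.
    rewrite -rmorphD; apply: alphaQ.
    by rewrite scalerDl opprD addrACA; apply: submodD.
  - move=> b a x; rewrite !big_seq1 /= -mulrA -mulrBr; apply: QM.
    rewrite -rmorphM; apply: alphaQ; rewrite -scalerA -scalerBr.
    exact: submodZ.
have s't'_eq : tensor_eq f [:: (1, s')] t'.
  by apply/tclassP; rewrite [RHS]tclassE -s't'.
have := tQ _ _ s't'_eq; rewrite big_seq1 mul1r => Q1.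
(* Elements of [N] admit the coefficient [0], so every term lies in [Q]. *)
have Qt : Q (\sum_(p <- t') p.1 * f (alpha p.2)).
  rewrite big_seq; elim/big_rec: _ => [|p x pt Qx]; first exact: submod0.
  apply: submodD => //; apply: QM; rewrite -[f _]subr0 -(rmorph0 f).
  rewrite -opprB -[- _]sub0r; apply: submodB; first exact: submod0.
  by apply: alphaQ; rewrite scale0r subr0; apply: t'N.
have Qs : Q (f (alpha s')).
  by rewrite -[f _](subrK (\sum_(p <- t') p.1 * f (alpha p.2))); apply: submodD.
(* The element [s] admits the coefficient [1], so [f (alpha s')] is [1] modulo [Q]. *)
rewrite -[1](subrK (f (alpha s'))); apply: submodD => //.
rewrite -[in X in Q (X - _)](rmorph1 f); apply: alphaQ.
by rewrite scale1r subrr; apply: submod0.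
Qed.

End FlatIdeal.

Local Open Scope classical_set_scope.

(** Zorn's lemma gives an ideal maximal among those containing [I] and avoiding [1]; such an ideal
    is prime. *)
Lemma exists_prime (A : comPzRingType) (I : submod A^o) : ~ I 1 ->
  exists P : A -> Prop, prime_set P /\ forall a, I a -> P a.
Proof.
move=> I1.
pose ideal (X : set A) := [/\ I `<=` X, ~ X 1,
  forall a b, X a -> X b -> X (a + b) & forall a b, X b -> X (a * b)].
have idealI : ideal I.
  by split=> // [a b|a b]; [apply: submodD|apply: submodZ].
have [|P [P_ideal P_max]] := @Zorn_bigcup A [set X | X = set0 \/ ideal X].
  move=> F FP F_tot.
  have F_ideal X a : F X -> X a -> ideal X.
    by move=> FX Xa; case: (FP _ FX) => // X0; rewrite X0 in Xa.
  have [[X FX X_ideal]|F0] := pselect (exists2 X, F X & ideal X); last first.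
    left; rewrite -subset0 => a [X FX Xa].
    by apply: F0; exists X => //; apply: F_ideal Xa.
  right; split.
  - by move=> a Ia; exists X => //; case: X_ideal => + _ _ _; apply.
  - by case=> Y FY Y1; case: (F_ideal _ _ FY Y1).
  - move=> a b [Y FY Ya] [Z FZ Zb].
    have [YZ|ZY] := F_tot _ _ FY FZ.
      exists Z => //; have [_ _ + _] := F_ideal _ _ FZ Zb.
      by apply=> //; apply: YZ.
    exists Y => //; have [_ _ + _] := F_ideal _ _ FY Ya.
    by apply=> //; apply: ZY.
  - move=> a b [Y FY Yb]; exists Y => //.
    by have [_ _ _] := F_ideal _ _ FY Yb; apply.
have {}P_ideal : ideal P.
  case: P_ideal => // P0; case: (P_max I); last by right.
  by rewrite P0; split=> // /(_ 0 (submod0 I)).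
have [IP P1 PD PM] := P_ideal; exists P; split; last exact: IP.
split=> //; first exact: IP _ (submod0 I).
move=> a b Pab; have [Pa|nPa] := pselect (P a); [by left|right].
(* [J] is the ideal [P + A a]. If [1 = p + c * a] then [b = b * p + c * (a * b)] is in [P];
   otherwise [J] contradicts maximality. *)
pose J : set A := [set x | exists p c, P p /\ x = p + c * a].
have PJ : P `<=` J by move=> p Pp; exists p, 0; rewrite mul0r addr0.
have [[p [c [Pp c1]]]|J1] := pselect (J 1).
  by rewrite -[b]mulr1 c1 mulrDr mulrCA [b * a]mulrC; apply: PD; apply: PM.
case: (P_max J).
  split=> // JP; apply: nPa; apply: JP; exists 0, 1.
  by rewrite mul1r add0r; split=> //; apply/IP/submod0.
right; split=> //; first by move=> x /IP/PJ.
  move=> x y [p [c [Pp ->]]] [q [d [Pq ->]]]; exists (p + q), (c + d).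
  by rewrite mulrDl addrACA; split=> //; apply: PD.
move=> x y [p [c [Pp ->]]]; exists (x * p), (x * c).
by rewrite mulrDr mulrA; split=> //; apply: PM.
Qed.

Local Close Scope classical_set_scope.

(** If the ideal of all [a] with [a *: s] in [N] were proper, a prime containing it would be the
    preimage of a prime [Q] of some [B i], and [flat_ideal] would put [1] in [Q]. *)
Lemma fppf_local_mem (A : comPzRingType) (n : nat) (B : 'I_n -> comPzRingType)
    (f : forall i, {rmorphism A -> B i}) (M : lmodType A) (N : submod M)
    (s : M) :
  (forall i, flat (f i)) -> jointly_surjective f ->
  (forall i, exists t : seq (B i * M), (forall p, p \in t -> N p.2) /\
     pure (f i) 1 s = \sum_(p <- t) pure (f i) p.1 p.2) ->
  N s.
Proof.
move=> f_flat f_surj s_loc.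
have I0 : N (0 *: s) by rewrite scale0r; apply: submod0.
have ID a b : N (a *: s) -> N (b *: s) -> N ((a + b) *: s).
  by rewrite scalerDl; apply: submodD.
have IZ a b : N (b *: s) -> N ((a * b) *: s).
  by rewrite -scalerA; apply: submodZ.
pose I : submod A^o := @Submod A A^o (fun a => N (a *: s)) I0 ID IZ.
rewrite -[s]scale1r; apply: contrapT.
move=> /(exists_prime (I := I))[P [P_prime IP]].
have [i [Q [[Q0 QD QM Q1 _] PQ]]] := f_surj P P_prime; apply: Q1.
have [t [tN st]] := s_loc i.
apply: (flat_ideal (Q := @Submod (B i) (B i)^o Q Q0 QD QM) (f_flat i) st tN).
by move=> a /IP /PQ.
Qed.

(** * Finite presentation *)

Section Expressions.
Variables (A B : comPzRingType).

Lemma eq_eval_expr (f f' : A -> B) n (b b' : 'I_n -> B) P :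
  f =1 f' -> b =1 b' -> eval_expr f b P = eval_expr f' b' P.
Proof.
move=> ff' bb'; apply: eq_bigr => t _; rewrite ff'.
by congr (_ * _); apply: eq_bigr => i _; rewrite bb'.
Qed.

Lemma rmorph_eval_expr (C : comPzRingType) (k : {rmorphism B -> C})
    (f : A -> B) n (b : 'I_n -> B) P :
  k (eval_expr f b P) = eval_expr (k \o f) (k \o b) P.
Proof.
rewrite rmorph_sum; apply: eq_bigr => t _.
rewrite rmorphM rmorph_prod; congr (_ * _).
by apply: eq_bigr => i _; rewrite rmorphXn.
Qed.

Definition map_expr (g : A -> B) n (P : polynomial_expr A n) :
    polynomial_expr B n := [seq (g t.1, t.2) | t <- P].

Lemma eval_map_expr (g : A -> B) (C : comPzRingType) (f : B -> C) n
    (c : 'I_n -> C) P :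
  eval_expr f c (map_expr g P) = eval_expr (f \o g) c P.
Proof. by rewrite /eval_expr big_map. Qed.

End Expressions.

(** The generators and relations are those of [f], with coefficients sent to [C]: a morphism out of
    the pushout is a compatible pair of morphisms out of [B] and [C]. *)
Lemma fp_base_change (A B C : comPzRingType) (f : {rmorphism A -> B})
    (g : {rmorphism A -> C}) :
  finitely_presented f ->
  finitely_presented (inpr f g : {rmorphism C -> pushout f g}).
Proof.
case=> n [b [m [P [P0 P_univ]]]].
exists n, (inpl f g \o b), m, (fun k => map_expr g (P k)); split=> [k|D h d hP].
  rewrite eval_map_expr -(rmorph0 (inpl f g)) -(P0 k) rmorph_eval_expr.
  by apply: eq_eval_expr => // a; rewrite [RHS](pushout_comm f g a).
have [k|u [[uh ud] u_uniq]] := P_univ D (h \o g : {rmorphism A -> D}) d.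
  by rewrite -(hP k) eval_map_expr.
have [k [ku kh]] := pushout_univ uh.
exists k; split; first by split=> // i; rewrite -[RHS]ud /= -[RHS]ku.
move=> k' k'h k'd; apply: pushout_ext => x; last by rewrite kh -k'h.
rewrite ku; apply: (u_uniq (k' \o inpl f g : {rmorphism B -> D})) => // a /=.
by rewrite -k'h; congr (k' _); apply: pushout_comm.
Qed.

Section Generated.
Variables (A B : comPzRingType) (f : {rmorphism A -> B}) (n : nat).
Variable b : 'I_n -> B.

Definition generated_pred : pred B :=
  fun x => `[< exists Q, x = eval_expr f b Q >].

Record generated : Type :=
  Generated { generated_val : B; _ : generated_pred generated_val }.

HB.instance Definition _ := [isSub for generated_val].
HB.instance Definition _ := [Choice of generated by <:].

Lemma generated_pred_closed : subring_closed generated_pred.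
Proof.
split=> [|_ _ /asboolP[P ->] /asboolP[Q ->]|_ _ /asboolP[P ->] /asboolP[Q ->]];
  apply/asboolP.
- exists [:: (1, fun=> 0%N)]; rewrite /eval_expr big_seq1 rmorph1 mul1r.
  by rewrite big1.
- exists (P ++ map_expr -%R Q); rewrite [RHS]big_cat /=; congr (_ + _).
  rewrite -[RHS]/(eval_expr _ _ _) eval_map_expr -sumrN; apply: eq_bigr => t _.
  by rewrite /= rmorphN mulNr.
- exists [seq (t.1 * u.1, fun i => (t.2 i + u.2 i)%N) | t <- P, u <- Q].
  rewrite [RHS]big_allpairs_dep big_distrl; apply: eq_bigr => t _.
  rewrite big_distrr; apply: eq_bigr => u _ /=.
  rewrite rmorphM mulrACA -big_split; congr (_ * _).
  by apply: eq_bigr => i _; rewrite exprD.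
Qed.

HB.instance Definition _ := GRing.SubChoice_isSubComPzRing.Build B
  generated_pred generated generated_pred_closed.

Lemma generated_cst a : generated_pred (f a).
Proof.
apply/asboolP; exists [:: (a, fun=> 0%N)].
by rewrite /eval_expr big_seq1 big1 ?mulr1.
Qed.

Lemma generated_gen i : generated_pred (b i).
Proof.
apply/asboolP; exists [:: (1, fun j => (j == i : nat))].
rewrite /eval_expr big_seq1 rmorph1 mul1r (bigD1 i) //= eqxx expr1.
by rewrite big1 ?mulr1 // => j /negbTE ->.
Qed.

(** [is_presentation] is only a universal property. It yields a morphism from [B] to the subring
    generated by the [b i] over [A], and uniqueness makes its composite with the inclusion the
    identity. *)
Lemma presentation_generated m (P : 'I_m -> polynomial_expr A n) :
  is_presentation f b P -> forall x, exists Q, x = eval_expr f b Q.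
Proof.
case=> P0 P_univ x.
pose f' a : generated := Generated (generated_cst a).
have f'B : zmod_morphism f' by move=> a a'; apply: val_inj; apply: rmorphB.
have f'M : monoid_morphism f'.
  by split=> [|a a']; apply: val_inj; [apply: rmorph1|apply: rmorphM].
pose fr : {rmorphism A -> generated} := HB.pack f'
  (GRing.isZmodMorphism.Build _ _ f' f'B)
  (GRing.isMonoidMorphism.Build _ _ f' f'M).
have [k|h [[hf hb] _]] :=
  P_univ generated fr (fun i => Generated (generated_gen i)).
  by apply: val_inj; rewrite rmorph_eval_expr rmorph0 -(P0 k).
have [k|h' [_ h'_uniq]] := P_univ B f b; first exact: P0.
have val_h : val \o h =1 idfun.
  move=> y; rewrite (h'_uniq (val \o h : {rmorphism B -> B})).
  - by rewrite (h'_uniq idfun).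
  - by move=> a /=; rewrite -[h _]/((h \o f) a) hf.
  - by move=> i /=; rewrite -[h _]/((h \o b) i) hb.
by have /asboolP[Q hQ] := valP (h x); exists Q; rewrite -hQ; apply/esym/val_h.
Qed.

End Generated.

Section CompExpr.
Variables (A : comPzRingType) (n n' : nat).

Definition cat_exponents (e : 'I_n -> nat) (e' : 'I_n' -> nat)
    (j : 'I_(n + n')) : nat :=
  match split j with inl i => e i | inr i => e' i end.

Lemma prod_cat_exponents (D : comPzRingType) (w : 'I_(n + n') -> D) e e' :
  \prod_j w j ^+ cat_exponents e e' j =
  (\prod_i w (lshift n' i) ^+ e i) * \prod_i w (rshift n i) ^+ e' i.
Proof.
rewrite big_split_ord; congr (_ * _); apply: eq_bigr => i _;
  by rewrite /cat_exponents ?(unsplitK (inl _)) ?(unsplitK (inr _)).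
Qed.

Definition widen_expr (P : polynomial_expr A n) : polynomial_expr A (n + n') :=
  [seq (t.1, cat_exponents t.2 (fun=> 0%N)) | t <- P].

Lemma eval_widen_expr (D : comPzRingType) (h : A -> D)
    (w : 'I_(n + n') -> D) P :
  eval_expr h w (widen_expr P) = eval_expr h (w \o @lshift n n') P.
Proof.
rewrite /eval_expr big_map; apply: eq_bigr => t _.
by rewrite prod_cat_exponents [X in _ * (_ * X)]big1 ?mulr1.
Qed.

(** Each coefficient in [B] is replaced by a polynomial over [A] representing it in the first [n]
    variables; the variables of [P] become the last [n']. *)
Definition subst_expr (B : comPzRingType) (Q : B -> polynomial_expr A n)
    (P : polynomial_expr B n') : polynomial_expr A (n + n') :=
  [seq (q.1, cat_exponents q.2 t.2) | t <- P, q <- Q t.1].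

Lemma eval_subst_expr (B D : comPzRingType) (h : A -> D)
    (w : 'I_(n + n') -> D) (Q : B -> polynomial_expr A n) P :
  eval_expr h w (subst_expr Q P) =
  eval_expr (fun x => eval_expr h (w \o @lshift n n') (Q x))
    (w \o @rshift n n') P.
Proof.
rewrite [LHS]big_allpairs_dep; apply: eq_bigr => t _.
rewrite big_distrl; apply: eq_bigr => q _ /=.
by rewrite prod_cat_exponents mulrA.
Qed.

End CompExpr.

(** Both sets of generators are joined, and so are the relations, once the coefficients of the
    second set are lifted to polynomials over [A] by [presentation_generated]. *)
Lemma fp_comp (A B C : comPzRingType) (f : {rmorphism A -> B})
    (g : {rmorphism B -> C}) :
  finitely_presented f -> finitely_presented g ->
  finitely_presented (g \o f : {rmorphism A -> C}).
Proof.
case=> n [b [m [P P_pres]]] [n' [c [m' [P' P'_pres]]]].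
have /choice[Q QE] := presentation_generated P_pres.
have [[P0 P_univ] [P'0 P'_univ]] := (P_pres, P'_pres).
pose d (j : 'I_(n + n')) :=
  match split j with inl i => g (b i) | inr i => c i end.
have dl i : d (lshift n' i) = g (b i) by rewrite /d (unsplitK (inl _)).
have dr i : d (rshift n i) = c i by rewrite /d (unsplitK (inr _)).
exists (n + n')%N, d, (m + m')%N, (fun k => match split k with
  inl k => widen_expr n' (P k) | inr k => subst_expr Q (P' k) end).
split=> [k|D h w hw].
  case: (split k) => {}k.
    rewrite eval_widen_expr -(rmorph0 g) -(P0 k) rmorph_eval_expr.
    by apply: eq_eval_expr.
  rewrite eval_subst_expr -(P'0 k); apply: eq_eval_expr => // x.
  by rewrite [in RHS](QE x) rmorph_eval_expr; apply: eq_eval_expr.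
have [k|u [[uh ub] u_uniq]] := P_univ D h (w \o @lshift n n').
  by have := hw (lshift m' k); rewrite (unsplitK (inl _)) eval_widen_expr.
have [k|v [[vu vc] v_uniq]] := P'_univ D u (w \o @rshift n n').
  have := hw (rshift m k); rewrite (unsplitK (inr _)) eval_subst_expr => <-.
  apply: eq_eval_expr => // x; rewrite [in LHS](QE x) rmorph_eval_expr.
  exact: eq_eval_expr.
exists v; split.
  split=> [a|j]; first by rewrite -[RHS]uh /= -[RHS]vu.
  rewrite -(splitK j); case: (split j) => i /=.
    by rewrite dl -[RHS]ub /= -[RHS]vu.
  by rewrite dr -[RHS]vc.
move=> v' v'h v'd.
apply: v_uniq => [x|i]; last by rewrite -[RHS]v'd /= dr.
apply: (u_uniq (v' \o g : {rmorphism B -> D})) => // i.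
by rewrite -[RHS]v'd /= dl.
Qed.

(** * Fibre products over the stack *)

(** Points of [S] are pushed along bundled morphisms, so pointwise equality has to be upgraded to
    equality. *)
Lemma eq_rmorphism (A B : comPzRingType) (f g : {rmorphism A -> B}) :
  f =1 g -> f = g.
Proof.
case: f g => f [[f1] [f2]] [g [[g1] [g2]]] /= /funext fg.
by subst g; rewrite (Prop_irrelevance f1 g1) (Prop_irrelevance f2 g2).
Qed.

Section Fibred.
Variables (S : ring_functor) (X : cat_over S) (X_fib : fibred_in_groupoids X).

Lemma pull_compm (U V W : aff S) (x : X U) (y : X V) (z : X W)
    (n : hom y z) (m : hom x y) a :
  pull (over (compm n m)) a = pull (over m) (pull (over n) a).
Proof. exact: over_comp. Qed.

(** In a category fibred in groupoids every arrow is Cartesian, so [k] is determined by [compm m k]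
    and its image in the base. *)
Lemma compm_inj (U V W : aff S) (x : X U) (y : X V) (z : X W)
    (m : hom y x) (k k' : hom z y) :
  compm m k = compm m k' -> aff_eq (over k) (over k') -> k = k'.
Proof.
move=> mk kk'; have [|k0 [_ k0_uniq]] :=
  X_fib.2 U V W x y z m (compm m k) (over k).
  by move=> a /=; rewrite pull_compm.
by rewrite -(k0_uniq k) // -(k0_uniq k') // mk; split=> // a; rewrite -kk'.
Qed.

Section FibreProduct.
Variables (V U W : aff S) (v : X V) (x : X U) (w : X W).
Variables (m : hom x v) (n : hom w v).

Definition pushout_aff : aff S :=
  Aff (push (inpl (pull (over m)) (pull (over n)) : {rmorphism _ -> _})
         (aff_point U)).

Record fibre_product := FibreProduct {
  fpr_obj : X pushout_aff;
  fpr_left : hom fpr_obj x;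
  fpr_right : hom fpr_obj w;
  fpr_comm : compm m fpr_left = compm n fpr_right;
  fpr_pull_left : pull (over fpr_left) =1 inpl (pull (over m)) (pull (over n));
  fpr_pull_right :
    pull (over fpr_right) =1 inpr (pull (over m)) (pull (over n));
  fpr_univ : forall (Z : aff S) (z : X Z) (a : hom z x) (b : hom z w),
    compm m a = compm n b ->
    exists k : hom z fpr_obj, compm fpr_left k = a /\ compm fpr_right k = b;
  fpr_ext : forall (Z : aff S) (z : X Z) (k k' : hom z fpr_obj),
    compm fpr_left k = compm fpr_left k' ->
    compm fpr_right k = compm fpr_right k' -> k = k' }.

(** The object is the pullback of [x] to the affine fibre product of the bases; its arrow to [w]
    exists because [n] is Cartesian. The ring-level universal property then lifts to the fibration
    in the same way. *)
Lemma exists_fibre_product : fibre_product.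
Proof.
pose p1 : {rmorphism U -> pushout_aff} := inpl (pull (over m)) (pull (over n)).
pose p2 : {rmorphism W -> pushout_aff} := inpr (pull (over m)) (pull (over n)).
have p12 : (p1 \o pull (over m) : {rmorphism _ -> _}) =
           (p2 \o pull (over n) : {rmorphism _ -> _}).
  by apply: eq_rmorphism; apply: pushout_comm.
have p2_point : push p2 (aff_point W) = aff_point pushout_aff.
  by rewrite -(pull_point (over n)) -push_comp -p12 push_comp pull_point.
pose hl : aff_hom pushout_aff U := @AffHom S pushout_aff U p1 erefl.
pose hr : aff_hom pushout_aff W := AffHom p2_point.
have [y /cid[l l_over]] := cid (X_fib.1 _ _ hl x).
have nl : aff_eq (aff_comp (over n) hr) (over (compm m l)).
  by move=> a; rewrite pull_compm l_over; apply/esym/pushout_comm.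
have [r [[nr r_over] _]] := cid (X_fib.2 _ _ _ _ _ _ n (compm m l) hr nl).
exists y l r => //.
- move=> Z z a b ab.
  have [|k [kl kr]] := @pushout_univ _ _ _ (pull (over m)) (pull (over n)) Z
    (pull (over a)) (pull (over b)).
    by move=> c /=; rewrite -!pull_compm ab.
  have k_point : push k (aff_point pushout_aff) = aff_point Z.
    rewrite -[LHS]push_comp -(pull_point (over a)); congr (push _ _).
    exact: eq_rmorphism.
  have [|k' [[lk' k'_over] _]] := X_fib.2 _ _ _ _ _ _ l a
    (@AffHom S Z pushout_aff k k_point).
    by move=> c /=; rewrite l_over -[RHS]kl.
  exists k'; split=> //; apply: (compm_inj (m := n)).
    by rewrite compA nr -compA lk'.
  by move=> c; rewrite pull_compm r_over k'_over -[RHS]kr.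
- move=> Z z k k' lkk' rkk'; apply: (compm_inj lkk').
  apply: pushout_ext => a /=.
    by rewrite -[inpl _ _ a]l_over -!pull_compm lkk'.
  by rewrite -[inpr _ _ a]r_over -!pull_compm rkk'.
Qed.

End FibreProduct.

Section FprodBaseChange.
Variables (V W T : aff S) (v : X V) (w : X W) (n : hom w v) (t : X T).

(** On points, the projection from [W x_X T] to [V x_X T]; it exhibits the former as the base change
    of the latter along [W -> V]. *)
Definition fprod_push (a : fprod w t) : fprod v t :=
  FprodObj (compm n (fp_left a)) (fp_right a).

Lemma fprod_push_hom_subproof (a b : fprod w t) (m : oa_hom a b) :
  compm (compm n (fp_left b)) (sval m) = compm n (fp_left a) /\
  compm (fp_right b) (sval m) = fp_right a.
Proof. by case: m => m [/= ml mr]; rewrite -compA ml. Qed.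

Definition fprod_push_hom (a b : fprod w t) (m : oa_hom a b) :
  oa_hom (fprod_push a) (fprod_push b) :=
  exist _ (sval m) (fprod_push_hom_subproof m).

Variable c : fprod v t.
Let P := exists_fibre_product n (fp_left c).

(* W x_V c, as a piece of W x_X T *)
Definition fprod_pullback : fprod w t :=
  FprodObj (fpr_left P) (compm (fp_right c) (fpr_right P)).

Lemma fprod_pullbackP (a : fprod w t) :
  inhabited (oa_hom a fprod_pullback) <-> inhabited (oa_hom (fprod_push a) c).
Proof.
split=> [[[m [ml mr]]]|[[m [ml mr]]]]; apply: inhabits.
  exists (compm (fpr_right P) m); split; last by rewrite compA.
  by rewrite compA -(fpr_comm P) -compA ml.
have /cid[k [kl kr]] := fpr_univ P (esym ml).
by exists k; split; rewrite //= -compA kr.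
Qed.

Lemma fprod_pullback_restricts (a : fprod w t) (J : oa_ring a -> Prop) :
  @restricts_to _ c (fprod_push a) J -> @restricts_to _ fprod_pullback a J.
Proof.
move=> cJ b m; rewrite fprod_pullbackP (cJ _ (fprod_push_hom m)).
exact: iff_refl.
Qed.

(** Two arrows into the pullback have the same component to [w], prescribed by [a], and the same
    component to [c], which is a monomorphism. The open image is that of [c] seen through
    [fprod_push]. *)
Lemma fprod_pullback_open : open_immersion c -> open_immersion fprod_pullback.
Proof.
case=> c_mono c_open; split=> [a m m'|a]; last first.
  have [J cJ] := c_open (fprod_push a).
  by exists J; apply: fprod_pullback_restricts.
have to_c (k : oa_hom a fprod_pullback) :
    compm (fp_left c) (compm (fpr_right P) (sval k)) = fp_left (fprod_push a) /\
    compm (fp_right c) (compm (fpr_right P) (sval k)) = fp_right (fprod_push a).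
  case: k => k [/= <- <-]; split; rewrite compA //.
  by rewrite -(fpr_comm P) -compA.
pose lift k : oa_hom (fprod_push a) c :=
  exist _ (compm (fpr_right P) (sval k)) (to_c k).
have sval_inj (k k' : oa_hom a fprod_pullback) : sval k = sval k' -> k = k'.
  case: k k' => [k p] [k' p'] /= kk'; subst k'.
  by rewrite (Prop_irrelevance p p').
apply: sval_inj; apply: (fpr_ext (f := P)).
  by case: (m) (m') => [k [/= -> _]] [k' [/= -> _]].
exact: (congr1 sval (c_mono _ (lift m) (lift m'))).
Qed.

End FprodBaseChange.

Lemma restricts_to_pull (V T : aff S) (v : X V) (t : X T) (c x y : fprod v t)
    (m : oa_hom y x) (J : oa_ring x -> Prop) :
  restricts_to c J -> restricts_to c (image_set (oa_pull m) J).
Proof.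
move=> cJ z k.
have km_hom : compm (fp_left x) (compm (sval m) (sval k)) = fp_left z /\
    compm (fp_right x) (compm (sval m) (sval k)) = fp_right z.
  by case: m k {cJ} => m [ml mr] [k [kl kr]] /=; rewrite !compA ml mr.
rewrite (cJ z (exist _ _ km_hom)).
rewrite (_ : image_set _ J =
  image_set (oa_pull k) (image_set (oa_pull m) J)) //.
rewrite funeqE => b; apply/propext; split=> [[a Ja ->]|[_ [a Ja ->] ->]].
  by exists (oa_pull m a); [exists a|apply: pull_compm].
by exists a => //; apply/esym/pull_compm.
Qed.

(** The pieces [c i] of [V x_X T] pull back to an affine cover of [W x_X T]. Each new piece maps to
    [T] by a base change of [W -> V] followed by the map of [c i], and the finite lists cutting out
    the overlaps are transported to their images. *)
Lemma flat_fp_pull (V W : aff S) (v : X V) (w : X W) (n : hom w v) :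
  flat (pull (over n)) -> finitely_presented (pull (over n)) ->
  flat_fp v -> flat_fp w.
Proof.
move=> n_flat n_fp v_flat_fp T t.
have [N [c [[c_open c_cover] c_flat_fp c_qs]]] := v_flat_fp T t.
exists N, (fun i => fprod_pullback n (c i)); split.
- split=> [i|x x_field]; first exact: fprod_pullback_open.
  have [i xi] := c_cover (fprod_push n x) x_field.
  by exists i; apply/fprod_pullbackP.
- move=> i; have [ci_flat ci_fp] := c_flat_fp i.
  set P := exists_fibre_product n (fp_left (c i)).
  have -> : fprod_to_right (fprod_pullback n (c i)) =
      (inpr (pull (over n)) (pull (over (fp_left (c i)))) \o
         fprod_to_right (c i) : {rmorphism _ -> _}).
    apply: eq_rmorphism => a; rewrite [LHS]pull_compm.
    exact: (fpr_pull_right P).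
  have p_flat := @flat_base_change _ _ _ _ (pull (over (fp_left (c i)))) n_flat.
  have p_fp := @fp_base_change _ _ _ _ (pull (over (fp_left (c i)))) n_fp.
  split; first exact: (@flat_comp _ _ _ _ _ ci_flat p_flat).
  exact: (@fp_comp _ _ _ _ _ ci_fp p_fp).
- move=> i j; have [J cJ] := c_qs i j.
  set P := exists_fibre_product n (fp_left (c j)).
  pose m : oa_hom (fprod_push n (fprod_pullback n (c j))) (c j) :=
    exist _ (fpr_right P) (conj (esym (fpr_comm P)) erefl).
  exists [seq oa_pull m a | a <- J].
  apply: fprod_pullback_restricts.
  rewrite (_ : (fun a => _) = image_set (oa_pull m) (fun a => a \in J)).
    exact: restricts_to_pull.
  rewrite funeqE => b; apply/propext; split=> [/mapP[a Ja ->]|[a Ja ->]].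
    by exists a.
  exact: map_f.
Qed.

End Fibred.

(** * Descent *)

(** [B] tensor [M] over [A] is the base change of [M] to the pushout, on which [rho] is injective.
    The morphism [p] is separate from [inpr] so that the lemma applies to restriction maps whose
    ring map is only provably equal to it. *)
Lemma base_change_inj (A B C : comPzRingType) (f : {rmorphism A -> B})
    (g : {rmorphism A -> C}) (M : lmodType C) (N : lmodType (pushout f g))
    (p : {rmorphism C -> pushout f g}) (rho : {linear M -> N | p \; *:%R}) :
  p = (inpr f g : {rmorphism _ -> _}) -> injective (tensor_ind rho) ->
  forall s t : seq (B * M),
    \sum_(q <- s) inpl f g q.1 *: rho q.2 =
    \sum_(q <- t) inpl f g q.1 *: rho q.2 ->
  \sum_(q <- s) pure f (M := restrict g M) q.1 q.2 =
  \sum_(q <- t) pure f (M := restrict g M) q.1 q.2.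
Proof.
move=> pE; subst p => rho_inj s t st.
have sumE u : tensor_ind rho (expand_tensor
    (\sum_(q <- u) pure f (M := restrict g M) q.1 q.2)) =
    \sum_(q <- u) inpl f g q.1 *: rho q.2.
  elim: u => [|q u IH]; first by rewrite !big_nil expand_tensor0 tensor_ind0.
  by rewrite !big_cons expand_tensorD expand_tensor_pure tensor_indD
    tensor_ind_pure IH.
apply: (can_inj (@expand_tensorK _ _ _ f g M)); apply: rho_inj.
by rewrite !sumE.
Qed.

(** * Finite products of modules *)

Section Product.
Variables (A : comPzRingType) (n : nat) (M : 'I_n -> lmodType A).

Definition dprod : Type := forall i, M i.

HB.instance Definition _ := gen_eqMixin dprod.
HB.instance Definition _ := gen_choiceMixin dprod.

Lemma dprod_ext (x y : dprod) : (forall i, x i = y i) -> x = y.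
Proof. exact: functional_extensionality_dep. Qed.

Definition dprod_zero : dprod := fun i => 0.
Definition dprod_opp (x : dprod) : dprod := fun i => - x i.
Definition dprod_add (x y : dprod) : dprod := fun i => x i + y i.
Definition dprod_scale (a : A) (x : dprod) : dprod := fun i => a *: x i.

Lemma dprod_addA : associative dprod_add.
Proof. by move=> x y z; apply: dprod_ext => i; apply: addrA. Qed.

Lemma dprod_addC : commutative dprod_add.
Proof. by move=> x y; apply: dprod_ext => i; apply: addrC. Qed.

Lemma dprod_add0 : left_id dprod_zero dprod_add.
Proof. by move=> x; apply: dprod_ext => i; apply: add0r. Qed.

Lemma dprod_addN : left_inverse dprod_zero dprod_opp dprod_add.
Proof. by move=> x; apply: dprod_ext => i; apply: addNr. Qed.

HB.instance Definition _ := GRing.isZmodule.Build dprod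
  dprod_addA dprod_addC dprod_add0 dprod_addN.

Lemma dprod_scaleA a b x :
  dprod_scale a (dprod_scale b x) = dprod_scale (a * b) x.
Proof. by apply: dprod_ext => i; apply: scalerA. Qed.

Lemma dprod_scale1 : left_id 1 dprod_scale.
Proof. by move=> x; apply: dprod_ext => i; apply: scale1r. Qed.

Lemma dprod_scaleDr : right_distributive dprod_scale +%R.
Proof. by move=> a x y; apply: dprod_ext => i; apply: scalerDr. Qed.

Lemma dprod_scaleDl x : {morph dprod_scale^~ x : a b / a + b}.
Proof. by move=> a b; apply: dprod_ext => i; apply: scalerDl. Qed.

HB.instance Definition _ := GRing.Zmodule_isLmodule.Build A dprod
  dprod_scaleA dprod_scale1 dprod_scaleDr dprod_scaleDl.

Definition dprod_proj i (x : dprod) : M i := x i.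

Lemma dprod_proj_is_linear i : linear (dprod_proj i).
Proof. by []. Qed.

HB.instance Definition _ i := GRing.isLinear.Build A dprod (M i) *:%R
  (dprod_proj i) (dprod_proj_is_linear i).

Definition dprod_inj i (x : M i) : dprod :=
  dfwith (T := fun i => M i) (fun=> 0) x.

Lemma dprod_inj_is_linear i : linear (@dprod_inj i).
Proof.
move=> a x y; apply: dprod_ext => j.
rewrite -[RHS]/(a *: dprod_inj x j + dprod_inj y j) /dprod_inj.
have [<-|ij] := eqVneq i j; first by rewrite !dfwith_in.
by rewrite !dfwith_out // scaler0 addr0.
Qed.

HB.instance Definition _ i := GRing.isLinear.Build A (M i) dprod *:%R
  (@dprod_inj i) (@dprod_inj_is_linear i).

Lemma dprod_sum (x : dprod) : x = \sum_i dprod_inj (x i).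
Proof.
apply: dprod_ext => j.
rewrite -[RHS]/(dprod_proj j _) raddf_sum (bigD1 j) //= big1 ?addr0.
  by rewrite /dprod_proj /dprod_inj dfwith_in.
by move=> i ij; rewrite /dprod_proj /dprod_inj dfwith_out.
Qed.

(** The identity of a finite product is the sum of the composites of projections and injections, a
    decomposition that survives tensoring. *)
Lemma tensor_dprod_ext (B : comPzRingType) (f : {rmorphism A -> B})
    (x y : tensor f dprod) :
  (forall i, tensor_map (dprod_proj i) x = tensor_map (dprod_proj i) y) ->
  x = y.
Proof.
have decomp z : z = \sum_i tensor_map (@dprod_inj i)
    (tensor_map (f := f) (dprod_proj i) z).
  elim/tensor_elim: z => [|b m|z z' hz hz'].
  - by rewrite big1 // => i _; rewrite !tensor_map0.
  - rewrite {1}[m]dprod_sum (big_morph _ (@pureDr _ _ f _ b) (pure0 f _ b)).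
    by apply: eq_bigr => i _; rewrite !tensor_map_pure.
  - rewrite {1}hz {1}hz' -big_split; apply: eq_bigr => i _.
    by rewrite !tensor_mapD.
by move=> xy; rewrite [x]decomp [y]decomp; apply: eq_bigr => i _; rewrite xy.
Qed.

End Product.

Section Descent.
Variables (S : ring_functor) (X : cat_over S) (X_fib : fibred_in_groupoids X).
Variables (F : module_presheaf X) (F_cart : cartesian F).
Variables (v : aff_over X) (n : nat) (u : 'I_n -> aff_over X).
Variables (f : forall i, ao_hom (u i) v) (f_cover : fppf_cover f).

Let A := structure_presheaf v.
Let phi i : {rmorphism A -> structure_presheaf (u i)} := structure_res (f i).
Let phi_flat i : flat (phi i) := (f_cover.1 i).1.
Let phi_fp i : finitely_presented (phi i) := (f_cover.1 i).2.

(** The difference [t - t'] restricts to zero on the cover, so by the injectivity in [cartesian] it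
    dies in each base change; the local criterion for the zero submodule, with the empty list as
    witness, concludes. *)
Lemma cartesian_separated (t t' : F v) :
  (forall i, res F (f i) t = res F (f i) t') -> t = t'.
Proof.
move=> tt'; apply/eqP; rewrite -subr_eq0; apply/eqP.
pose Z : submod (F v) := @Submod A (F v) (fun x => x = 0) erefl
  (fun x y => ltac:(by move=> -> ->; rewrite addr0))
  (fun a x => ltac:(by move=> ->; rewrite scaler0)).
apply: (fppf_local_mem (N := Z) phi_flat f_cover.2) => i; exists [::].
split=> //; rewrite big_nil; apply: (bij_inj (F_cart (f i))).
by rewrite tensor_ind_pure tensor_ind0 scale1r raddfB /= tt' subrr.
Qed.

Let M i : lmodType A := restrict (phi i) (F (u i)).

Let cover_res (m : F v) : dprod M := fun i => res F (f i) m.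

Definition cover_image : submod (dprod M).
Proof.
apply: (@Submod A (dprod M) (fun s => exists m, s = cover_res m)).
- exists 0; apply: dprod_ext => i; exact/esym/raddf0.
- move=> _ _ [x ->] [y ->]; exists (x + y).
  by apply: dprod_ext => i; apply/esym/raddfD.
- move=> a _ [x ->]; exists (a *: x).
  by apply: dprod_ext => i; apply/esym/linearZ.
Defined.

Lemma cartesian_glue (s : forall i, F (u i)) :
  (forall (i j : 'I_n) (w : aff_over X) (a : ao_hom w (u i))
     (b : ao_hom w (u j)),
     compm (f i) a = compm (f j) b -> res F a (s i) = res F b (s j)) ->
  exists t : F v, forall i, res F (f i) t = s i.
Proof.
move=> s_compat.
suff [t st] : cover_image (s : dprod M).
  by exists t => i; rewrite [in RHS]st.
apply: (fppf_local_mem phi_flat f_cover.2) => k.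
(* Surjectivity in [cartesian] for [f k] writes [s k] as a combination of restrictions of sections
   over [v], with coefficients in the ring of [u k]. *)
have [y [t ty]] : exists (y : tensor (phi k) (F v)) t,
    tensor_ind (res F (f k)) y = s k /\ y = \sum_(p <- t) pure (phi k) p.1 p.2.
  have [h _ hK] := F_cart (f k); have [t ht] := tensor_sumP (h (s k)).
  by exists (h (s k)), t.
(* The same combination is claimed to represent the whole family [s] after base change to [u k]. *)
exists [seq (p.1, cover_res p.2) | p <- t]; split.
  by move=> _ /mapP[p _ ->]; exists p.2.
apply: tensor_dprod_ext => i.
rewrite big_map tensor_map_pure.
have -> : tensor_map (dprod_proj (M := M) i)
    (\sum_(p <- t) pure (phi k) p.1 (cover_res p.2)) =
  \sum_(p <- [seq (p.1, res F (f i) p.2) | p <- t])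
    pure (phi k) (M := M i) p.1 p.2.
  rewrite big_map raddf_sum; apply: eq_bigr => p _.
  exact: tensor_map_pure.
have -> : pure (phi k) 1 (dprod_proj (M := M) i s) =
    \sum_(p <- [:: (1, s i)]) pure (phi k) (M := M i) p.1 p.2.
  by rewrite big_seq1.
(* The two sides of component [i] are compared in the sections over the overlap of [u k] and [u i];
   this requires the overlap to be an object of the site. *)
have P := exists_fibre_product X_fib (f k) (f i).
have w_flat_fp : flat_fp (fpr_obj P).
  have rE : pull (over (fpr_right P)) =
      (inpr (phi k) (phi i) : {rmorphism _ -> _}).
    by apply: eq_rmorphism => a; apply: (fpr_pull_right P).
  apply: (flat_fp_pull X_fib (n := fpr_right P) _ _ (ao_flat_fp (u i))).
    rewrite rE; exact (@flat_base_change _ _ _ _ (phi i) (@phi_flat k)).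
  by rewrite rE; exact (@fp_base_change _ _ _ _ (phi i) (phi_fp k)).
pose w := AffOver w_flat_fp.
pose l : ao_hom w (u k) := fpr_left P.
pose r : ao_hom w (u i) := fpr_right P.
apply: (base_change_inj (rho := res F r)).
- by apply: eq_rmorphism => a; apply: (fpr_pull_right P).
- exact: (bij_inj (F_cart r)).
(* On the overlap [s i] agrees with [s k], and restricting from [v] through [u k] or through [u i]
   gives the same result, so the expansion of [s k] becomes the required sum. *)
rewrite big_seq1 big_map rmorph1 scale1r -(s_compat k i w l r (fpr_comm P)).
case: ty => <- ->; elim: t => [|p t IH].
  by rewrite !big_nil tensor_ind0 raddf0.
rewrite !big_cons tensor_indD tensor_ind_pure raddfD /= IH; congr (_ + _).
rewrite linearZ /= -!res_comp (fpr_comm P).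
by rewrite [structure_res l _](fpr_pull_left P).
Qed.

End Descent.

Theorem lemma3p7 (S : ring_functor) (hS : is_scheme S) (X : cat_over S)
    (hX : geometric_stack X) (F : module_presheaf X) (hF : cartesian F) :
  is_sheaf F.
Proof.
case: hX => -[X_fib _ _] _ _ v n u f f_cover s s_compat.
have [t st] := cartesian_glue X_fib hF f_cover s_compat.
exists t; split=> // t' st'.
by apply: (cartesian_separated hF f_cover) => i; rewrite st st'.
Qed.
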